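(* For every $n\ge k\ge 0$ with $n-k$ even, \[\sum_{m\in\mathcal{M}_{n,k}}q^{\mathrm{crn}(m)}\mathbf{x}^{\mathrm{MDes}(m)}=\sum_{m\in\mathcal{M}_{n,k}}q^{\mathrm{nest}(m)}\mathbf{x}^{\mathrm{Des}(m)}.\]
   Context: $\mathcal{M}_{n,k}$ is the set of partial matchings on $[n]=\{1,\dots,n\}$ with exactly $k$ unmatched points; a matching is identified with the involution in $S_n$ whose 2-cycles are its matched pairs. $\mathrm{Des}(m)=\{i\in[n-1]:\pi_i>\pi_{i+1}\}$ for the one-line notation of this involution. $\mathrm{MDes}(m)$ is the set of $i\in[n-1]$ such that (1) $\{i,i+1\}$ is a matched pair; or (2) $i,i+1$ are matched with partners $a,b$, $\{i,a\}\ne\{i+1,b\}$, and the arcs $\{i,a\},\{i+1,b\}$ cross (arcs $\{x_1<y_1\},\{x_2<y_2\}$ cross if $x_1<x_2<y_1<y_2$ or $x_2<x_1<y_2<y_1$); or (3) $i$ is unmatched and $i+1$ is matched. The crossing number $\mathrm{crn}(m)$ is the maximal $r$ such that there are matched pairs $\{i_1,j_1\},\dots,\{i_r,j_r\}$ with $i_1<\dots<i_r<j_1<\dots<j_r$; the nesting number $\mathrm{nest}(m)$ is the maximal $r$ such that there are matched pairs with $i_1<\dots<i_r<j_r<\dots<j_1$ (both are $0$ if there are no pairs). $\mathbf{x}^J=\prod_{j\in J}x_j$. *)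

(* Defs.v *)
From HB Require Import structures.
From mathcomp Require Import all_boot all_order all_fingroup all_algebra.
From mathcomp Require Import mpoly.

Set Implicit Arguments.
Unset Strict Implicit.
Unset Printing Implicit Defensive.

Import Order.TTheory GRing.Theory.
Local Open Scope nat_scope.

(** The point [p] of {1, ..., n} is the ordinal [p.-1 : 'I_n].  A partial
    matching is the involution [m : {perm 'I_n}] exchanging the two ends of
    every arc, so that unmatched points are fixed points. *)
Definition unmatched n (m : {perm 'I_n}) (i : 'I_n) : bool := m i == i.

Definition matched_pair n (m : {perm 'I_n}) (i j : 'I_n) : bool :=
  (i != j) && (m i == j).

Definition matchings (n k : nat) : {set {perm 'I_n}} :=
  [set m : {perm 'I_n} | [forall i, m (m i) == i]
                         && (#|[set i | unmatched m i]| == k)].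

Lemma succ_subproof n (i : 'I_n.-1) : i.+1 < n.
Proof. by rewrite -ltn_predRL. Qed.

(** An ordinal [i : 'I_n.-1] encodes the element [i.+1] of {1, ..., n-1};
    [pt i] and [pt_succ i] are this point and its successor in {1, ..., n}. *)
Definition pt n (i : 'I_n.-1) : 'I_n := widen_ord (leq_pred n) i.
Definition pt_succ n (i : 'I_n.-1) : 'I_n := Ordinal (succ_subproof i).

Definition Des n (m : {perm 'I_n}) : {set 'I_n.-1} :=
  [set i | m (pt i) > m (pt_succ i)].

(** The arcs [{a, b}] and [{c, d}] cross; the ends of an arc may be given in
    either order. *)
Definition arcs_cross n (a b c d : 'I_n) : bool :=
  let x1 := minn a b in let y1 := maxn a b in
  let x2 := minn c d in let y2 := maxn c d in
  [&& x1 < x2, x2 < y1 & y1 < y2] || [&& x2 < x1, x1 < y2 & y2 < y1].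

Definition MDes n (m : {perm 'I_n}) : {set 'I_n.-1} :=
  [set i | let p := pt i in let p' := pt_succ i in
    [|| matched_pair m p p',
        [&& ~~ unmatched m p, ~~ unmatched m p',
            [set p; m p] != [set p'; m p'] & arcs_cross p (m p) p' (m p')]
      | unmatched m p && ~~ unmatched m p']].

(** [u = (i_1, ..., i_r)] and [v = (j_1, ..., j_r)]: the chain of
    inequalities says that [u ++ v], resp. [u ++ rev v], is strictly
    increasing. *)
Definition has_crossing n (m : {perm 'I_n}) (r : nat) : bool :=
  [exists u : r.-tuple 'I_n, exists v : r.-tuple 'I_n,
    [forall a, matched_pair m (tnth u a) (tnth v a)]
    && sorted ltn [seq val i | i <- u ++ v]].

Definition has_nesting n (m : {perm 'I_n}) (r : nat) : bool :=
  [exists u : r.-tuple 'I_n, exists v : r.-tuple 'I_n,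
    [forall a, matched_pair m (tnth u a) (tnth v a)]
    && sorted ltn [seq val i | i <- u ++ rev v]].

(** Bounding [r] by [n] loses nothing, since [i_1, ..., i_r] are distinct
    points among [n]. *)
Definition crn n (m : {perm 'I_n}) : nat :=
  \max_(r < n.+1 | has_crossing m r) r.

Definition nest n (m : {perm 'I_n}) : nat :=
  \max_(r < n.+1 | has_nesting m r) r.

Local Open Scope ring_scope.

Definition xmon n (J : {set 'I_n.-1}) : {mpoly int[n.-1]} := \prod_(j in J) 'X_j.

(* Main.v *)
(** Write a matching as a 0/1 filling of a triangular board, the arc [i < j]
    being the cell in column [i] and row [j], and let labels travel through the
    board from the corner where [i] is small and [j] is large: a filled cell emits
    the label 0 along its row and its column, two equal labels [a] meeting in a
    cell both become [a + 1], and otherwise labels cross unchanged. These are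
    Fomin's growth rules for the Robinson-Schensted correspondence, a label being
    the row of the box that is added; the labels arriving at the diagonal spell
    a closed walk in Young's lattice, and every such walk arises exactly once.
    Let [w] be this walk, recorded by the rows of the boxes, and [w'] the same
    walk recorded by the columns. Viennot's shadow argument shows that the crossing
    number is the height of [w], and last passage percolation that the nesting
    number is the height of [w']. Comparing two adjacent lines of the board shows
    that [MDes] is the descent set of [w] and [Des] that of [w'], for two orders
    on the letters which differ only in the position of the letter "stand still".
    Both [w] and [w'] range over all closed walks. For a fixed [J], sorting each
    block of a word cut at [J] by the other order only moves letters "stand still",
    hence preserves closed walks and the height, and it exchanges the words whose
    descents lie in [J] for the two orders. *)
Require Import Defs.
From HB Require Import structures.
From mathcomp Require Import all_boot all_order all_fingroup all_algebra.
From mathcomp Require Import mpoly zify.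

Set Implicit Arguments.
Unset Strict Implicit.
Unset Printing Implicit Defensive.

Import Order.TTheory GRing.Theory.

Local Open Scope nat_scope.

(** * Walks in Young's lattice and their conjugates *)

(* A step of a walk on partitions: [None] stands still, [Some (true, a)] adds a
   box to row [a] (counted from 0), [Some (false, a)] removes one. *)
Definition letter : Type := option (bool * nat).

Definition removal (p : letter) : option nat :=
  if p is Some (false, a) then Some a else None.
Definition addition (p : letter) : option nat :=
  if p is Some (true, a) then Some a else None.

Definition upd (p : letter) (lam : nat -> nat) : nat -> nat :=
  match p with
  | None => lam
  | Some (true, a) => fun b => lam b + (b == a)
  | Some (false, a) => fun b => lam b - (b == a)
  end.

Definition can (p : letter) (lam : nat -> nat) : bool :=
  match p with
  | None => true
  | Some (true, a) => (a == 0) || (lam a < lam a.-1)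
  | Some (false, a) => lam a.+1 < lam a
  end.

Definition part (lam : nat -> nat) : Prop := forall a, lam a.+1 <= lam a.

Fixpoint walk (lam : nat -> nat) (w : seq letter) : Prop :=
  if w is p :: w' then can p lam /\ walk (upd p lam) w' else forall a, lam a = 0.

Fixpoint state (lam : nat -> nat) (w : seq letter) (t : nat) : nat -> nat :=
  match t, w with
  | t'.+1, p :: w' => state (upd p lam) w' t'
  | _, _ => lam
  end.

Definition column (lam : nat -> nat) (p : letter) : letter :=
  match p with
  | None => None
  | Some (true, a) => Some (true, lam a)
  | Some (false, a) => Some (false, (lam a).-1)
  end.

Fixpoint columns (lam mu : nat -> nat) (w : seq letter) : seq letter :=
  if w is p :: w' then
    column lam p :: columns (upd p lam) (upd (column lam p) mu) w'
  else [::].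

Definition conjugate (lam mu : nat -> nat) : Prop :=
  forall i j, (j < lam i) = (i < mu j).

Lemma upd_part p lam : part lam -> can p lam -> part (upd p lam).
Proof.
case: p => [[[] b]|] //= pl cn a; have := pl a;
  by case: (a =P b) => e1; case: (a.+1 =P b) => e2; subst; move: cn => /=; lia.
Qed.

(** The box of an admissible step is a corner, so its reflection is a corner too: [mu (lam a) = a]
    for an addition, and [mu (lam a).-1 = a.+1] for a removal. *)
Lemma conjugate_column lam mu p : conjugate lam mu -> can p lam ->
  column mu (column lam p) = p.
Proof.
move=> c; case: p => [[[] a]|] //= cn; congr (Some (_, _)).
  have h1 := c a (lam a); have h2 := c a.-1 (lam a); rewrite ltnn in h1.
  case/orP: cn => [/eqP a0|h3]; first by lia.
  by rewrite h3 in h2; lia.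
have h1 := c a (lam a).-1; have h2 := c a.+1 (lam a).-1.
lia.
Qed.

Lemma can_column lam mu p : conjugate lam mu -> can p lam ->
  can (column lam p) mu.
Proof.
move=> c cn; have := conjugate_column c cn.
case: p cn => [[[] a]|] //= cn [e].
  case E : (lam a) => [//|l] /=; rewrite -E e -c E; lia.
have := c a (lam a); have -> : (lam a).-1.+1 = lam a by lia.
by have := c a (lam a).-1; rewrite ltnn; lia.
Qed.

Lemma conjugate_upd lam mu p : conjugate lam mu -> can p lam ->
  conjugate (upd p lam) (upd (column lam p) mu).
Proof.
move=> c cn; have := conjugate_column c cn.
case: p cn => [[[] a]|] //= cn [e] i j; have := c i j.
  by case: (i =P a) => [->|]; case: (j =P lam a) => [->|]; rewrite ?e; lia.
have := c a (lam a).-1.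
by case: (i =P a) => [->|]; case: (j =P (lam a).-1) => [->|]; lia.
Qed.

Lemma size_columns lam mu w : size (columns lam mu w) = size w.
Proof. by elim: w lam mu => //= p w IH lam mu; rewrite IH. Qed.

Lemma columnsK lam mu w : conjugate lam mu -> walk lam w ->
  columns mu lam (columns lam mu w) = w.
Proof.
elim: w lam mu => //= p w IH lam mu c [cn wk].
rewrite (conjugate_column c cn) IH //.
exact: conjugate_upd.
Qed.

Lemma walk_columns lam mu w : conjugate lam mu -> walk lam w ->
  walk mu (columns lam mu w).
Proof.
elim: w lam mu => [|p w IH] lam mu c /=.
  by move=> l0 j; have := c 0 j; rewrite l0; case: (mu j) => // ? /=.
move=> [cn wk]; split; first exact: can_column.
by apply: IH => //; apply: conjugate_upd.
Qed.

Lemma walk_filter lam w : walk lam [seq p <- w | isSome p] <-> walk lam w.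
Proof.
elim: w lam => //= -[[b a]|] w IH lam /=; last by rewrite IH; split => // -[].
by split=> -[cn /IH wk]; split.
Qed.


(** The steps are stated as an equality of sums, which loses nothing to truncated subtraction. *)
Lemma walk_state lam w : part lam -> walk lam w ->
  [/\ forall t, part (state lam w t), forall a, state lam w (size w) a = 0 &
      forall t, t < size w -> forall b,
        state lam w t b + (addition (nth None w t) == Some b)
        = state lam w t.+1 b + (removal (nth None w t) == Some b)].
Proof.
elim: w lam => [|p w IH] lam pl; first by split=> // -[].
move=> [cn /(IH _ (upd_part pl cn)) [h1 h2 h3]]; split=> //; first by case.
move=> [_|t /h3] // b; case: w {IH h1 h2 h3} => [|q w] /=;
  by case: p cn => [[[] a]|] //= cn; rewrite ?(inj_eq Some_inj) [b == a]eq_sym //=;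
     case: (a =P b) cn => [->|]; rewrite ?addn0; lia.
Qed.

(** Admissibility need not be assumed: when both ends of a step are partitions, the changed box must
    be a corner. This turns the partitions along the diagonal of the board into a walk. *)
Lemma walk_intro lam w (S : nat -> nat -> nat) : S 0 =1 lam ->
  (forall t, t <= size w -> part (S t)) -> S (size w) =1 (fun=> 0) ->
  (forall t, t < size w -> forall b,
        S t b + (addition (nth None w t) == Some b)
        = S t.+1 b + (removal (nth None w t) == Some b)) ->
  walk lam w /\ forall t, t <= size w -> state lam w t =1 S t.
Proof.
elim: w lam S => [|p w IH] lam S S0 Sp Sz Se.
  by split=> [a|[|//] _ a] /=; rewrite -S0 ?Sz.
have e0 b := Se 0 isT b.
have e1 : S 1 =1 upd p lam.
  move=> b; have := e0 b; rewrite S0 /=.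
  case: p {Se e0 Sp Sz} => [[[] a]|] /=; rewrite ?(inj_eq Some_inj) ?[a == b]eq_sym; lia.
have [//||//||wk st] := IH (upd p lam) (fun t => S t.+1).
- by move=> t ht; apply: Sp.
- by move=> t ht; apply: (Se t.+1).
split; last by move=> [|t] //= ht a; [rewrite S0 | rewrite st].
split=> //; have := Sp 1 isT; have := Sp 0 isT; rewrite /part.
case: p {Se wk st IH Sp Sz} e0 e1 => [[[] a]|] //= e0 e1 p0 p1.
  case: a e0 e1 => // a e0 e1; have := p1 a; have := p0 a.
  have := e0 a; have := e0 a.+1; rewrite /= !(inj_eq Some_inj) !S0; lia.
have := p1 a; have := p0 a; have := e0 a; have := e0 a.+1.
rewrite /= !(inj_eq Some_inj) !S0; lia.
Qed.

(** * Orders on letters *)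

(* The two orders differ only in the place of [None]: last when [b] holds, and
   otherwise between removals and additions. *)
Definition le_letter (b : bool) (p q : letter) : bool :=
  match p, q with
  | Some (false, a), Some (false, a') => a <= a'
  | Some (false, _), _ => true
  | None, Some (true, _) => ~~ b
  | None, None => true
  | Some (true, a), Some (true, a') => a' <= a
  | Some (true, _), None => b
  | _, Some (false, _) => false
  end.

Lemma le_letter_total b : total (le_letter b).
Proof.
by move=> [[[] a]|] [[[] a']|] //=; try (by case: b); lia.
Qed.

Lemma le_letter_trans b : transitive (le_letter b).
Proof.
by move=> [[[] y]|] [[[] x]|] [[[] z]|] //=; case: b => //=; lia.
Qed.

Lemma le_letter_anti b : antisymmetric (le_letter b).
Proof.
move=> [[[] y]|] [[[] x]|] //=; try (by case: b);
  by rewrite -eqn_leq => /eqP ->.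
Qed.

(** Two boxes added in succession go weakly left exactly when they go strictly down, and two boxes
    removed go weakly right exactly when they go strictly up. This follows from the monotonicity of
    row lengths; admissibility of the steps gives the strict cases. *)
Lemma nth_columns_order lam mu w t : part lam -> walk lam w -> t.+1 < size w ->
  let w' := columns lam mu w in
  le_letter false (nth None w' t) (nth None w' t.+1)
  = match nth None w t, nth None w t.+1 with
    | Some (true, a), Some (true, a') => a < a'
    | Some (false, a), Some (false, a') => a' < a
    | Some (false, _), _ => true
    | None, q => if q is Some (false, _) then false else true
    | Some (true, _), _ => false
    end.
Proof.
elim: w lam mu t => [//|p w IH] lam mu t pl [cn wk] ht.
case: t ht => [|t] ht; last by apply: IH => //; apply: upd_part.
case: w {IH} wk ht => [//|q w] [cq _] _ /=.
have mono a a' : a <= a' -> lam a' <= lam a.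
  by elim: a' => [|a' IH]; [case: a | rewrite leq_eqVlt => /predU1P [->//|/IH]; apply: leq_trans].
case: p cn cq => [[[] a]|]; case: q => [[[] a']|] //= cp cq.
all: have := mono a a'; have := mono a' a; have := mono a'.+1 a; have := mono a' a.-1; have := mono a.+1 a'.
all: by case: (a' =P a) cq => [->|]; lia.
Qed.

(** * Height of a walk *)

(** Removals suffice: a closed walk must empty every row that it has reached. *)
Definition height (w : seq letter) : nat :=
  \max_(p <- w) (if removal p is Some a then a.+1 else 0).

Lemma height_gt w r :
  r < height w = has (fun p => if removal p is Some a then r <= a else false) w.
Proof.
rewrite /height; elim: w => [|p w IH] /=; first by rewrite big_nil.
by rewrite big_cons leq_max IH; case: (removal p).
Qed.

(** Every box of the first row has to be removed at some time, and a removal in column [c] occurs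
    only when the first row is longer than [c]. *)
Lemma height_columns lam mu w r : part lam -> walk lam w ->
  (r < height (columns lam mu w)) <-> exists2 t, t <= size w & r < state lam w t 0.
Proof.
move=> pl wk; rewrite height_gt; elim: w lam mu pl wk => [|p w IH] lam mu pl /=.
  by move=> l0; split=> // -[[|//] _] /=; rewrite l0.
move=> [cn wk]; set tl := has _ _.
have {}IH : tl <-> exists2 t, t <= size w & r < state (upd p lam) w t 0.
  by apply: IH => //; apply: upd_part.
have mono a : lam a <= lam 0.
  by elim: a => // a; apply: leq_trans.
split.
  case/orP => [|/IH [t ht hr]]; last by exists t.+1.
  by case: p cn {wk tl IH} => [[[] a]|] //= cn hr; exists 0 => //=; have := mono a; lia.
case=> -[_|t ht] /= hr; last by apply/orP; right; apply/IH; exists t.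
have [hr'|hr'] := ltnP r (upd p lam 0).
  by apply/orP; right; apply/IH; exists 0 => //; case: (w).
(* The first row is longer than [r] before this step and not after it, so the step removes its last
   box. *)
apply/orP; left; case: p hr' cn {wk tl IH} => [[[] a]|] /=; try lia.
by case: a => [|a] /=; lia.
Qed.

(** * Growth rules on a board *)

Definition cell (x : bool) (v h : option nat) : option nat * option nat :=
  if x then (Some 0, Some 0) else
  if v is Some a then if h == Some a then (Some a.+1, Some a.+1) else (v, h)
  else (v, h).

(* [v i r] and [h i r] are the labels with which row [r] and column [i] enter
   the cell [(i, r)], whose outputs are [v i.+1 r] and [h i r.+1]. *)
Definition labelling (X : nat -> nat -> bool) (v h : nat -> nat -> option nat) : Prop :=
  [/\ forall r, v 0 r = None, forall i, h i 0 = None &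
      forall i r, (v i.+1 r, h i r.+1) = cell (X i r) (v i r) (h i r)].

Definition rook (X : nat -> nat -> bool) : Prop :=
  (forall i r r', X i r -> X i r' -> r = r') /\
  (forall i i' r, X i r -> X i' r -> i = i').

(** The labels entering the cell [(i, s - i)], by recursion on the antidiagonal [s]; this makes the
    mutual recursion of row and column labels structural. *)
Fixpoint diag (X : nat -> nat -> bool) (s i : nat) : option nat * option nat :=
  if s is s'.+1 then
    (if i is i'.+1 then
       (cell (X i' (s' - i')) (diag X s' i').1 (diag X s' i').2).1 else None,
     if i <= s' then (cell (X i (s' - i)) (diag X s' i).1 (diag X s' i).2).2 else None)
  else (None, None).

Definition rlab X i r := (diag X (i + r) i).1.
Definition clab X i r := (diag X (i + r) i).2.

Lemma labelling_lab X : labelling X (rlab X) (clab X).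
Proof.
split; first by case.
  by case=> [|i]; rewrite /clab addn0 //= ltnn.
move=> i r; rewrite /rlab /clab addSn addnS /= leq_addr addKn.
by case: cell.
Qed.

Lemma cell_tr x v h : cell x h v = ((cell x v h).2, (cell x v h).1).
Proof.
rewrite /cell; case: x => //; case: h => [a|]; case: v => [b|] //=.
by rewrite ![Some _ == _](inj_eq Some_inj) [b == a]eq_sym; case: eqP => [->|].
Qed.

Lemma labelling_tr X v h : labelling X v h ->
  labelling (fun i r => X r i) (fun i r => h r i) (fun i r => v r i).
Proof.
move=> [v0 h0 vh]; split=> // i r.
by rewrite cell_tr -vh.
Qed.

Lemma rook_tr X : rook X -> rook (fun i r => X r i).
Proof. by move=> [r1 r2]; split=> [i r r'|i i' r]; [apply: r2 | apply: r1]. Qed.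

(** For a rook filling, these are the cells that emit the label [a], the corners of Viennot's shadow
    lines of depth [a]. *)
Definition level (X : nat -> nat -> bool) (v h : nat -> nat -> option nat) a i r : bool :=
  if a is b.+1 then (v i r == Some b) && (h i r == Some b) else X i r.

Lemma level_tr X v h a i r :
  level (fun i r => X r i) (fun i r => h r i) (fun i r => v r i) a r i = level X v h a i r.
Proof. by case: a => //= a; rewrite andbC. Qed.

Section Rows.

Variables (X : nat -> nat -> bool) (v h : nat -> nat -> option nat).
Hypotheses (rX : rook X) (lX : labelling X v h).

Local Notation level := (level X v h).

Lemma row_step i r : v i.+1 r = if X i r then Some 0 else
  if v i r is Some a then if h i r == Some a then Some a.+1 else Some a else None.
Proof.
have [_ _ vh] := lX; have /(congr1 fst) /= -> := vh i r.
by rewrite /cell; case: (X i r) => //; case: (v i r) => // a; case: ifP.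
Qed.

Lemma row_neq0 i r : v i r != None -> exists2 i', i' < i & X i' r.
Proof.
have [v0 _ _] := lX.
elim: i => [|i IH]; first by rewrite v0.
rewrite row_step; case E: (X i r); first by exists i.
case: (v i r) IH => // a [//|i' hi x'] _; exists i' => //; exact: ltnW.
Qed.

Lemma rook_row i i' r : X i' r -> i' < i -> v i r != None.
Proof.
move=> x'; elim: i => // i IH; rewrite ltnS leq_eqVlt => /predU1P[<-|/IH].
  by rewrite row_step x'.
by rewrite row_step; case: (v i r) => // a _; case: (X i r) => //; case: ifP.
Qed.

Lemma rook_row_none i r : X i r -> v i r = None.
Proof.
move=> x; apply/eqP/negPn/negP => /row_neq0 [i' hi x'].
by move: hi; rewrite (proj2 rX _ _ _ x x') ltnn.
Qed.

Lemma level_row a i r : level a i r -> v i.+1 r = Some a.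
Proof.
rewrite row_step; case: a => [|a] /=; first by move=> ->.
move=> /andP[/eqP va /eqP ->]; case E: (X i r); last by rewrite va eqxx.
by rewrite (rook_row_none E) in va.
Qed.

(** A label persists until it meets its equal, so it can be traced back to the cell that emitted
    it. *)
Lemma row_back a i r : v i r = Some a ->
  exists i', [/\ i' < i, level a i' r & forall j, i' < j <= i -> v j r = Some a].
Proof.
have [v0 _ _] := lX.
elim: i => [|i IH] vi; first by rewrite v0 in vi.
have [va|va] := eqVneq (v i r) (Some a).
  have [i' [hi lv hj]] := IH va; exists i'; split=> //; first exact: ltnW.
  by move=> j /andP[h1]; rewrite leq_eqVlt => /predU1P[->//|h2]; apply: hj; rewrite h1.
exists i; split=> //; last by move=> j hj; have -> : j = i.+1 by lia.
move: vi; rewrite row_step; case E: (X i r); first by case=> <-.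
case E2: (v i r) va => [b|] //; case: ifP => // /eqP hb hn.
  by case=> <-; rewrite /= E2 hb eqxx.
by case=> e; rewrite e eqxx in hn.
Qed.

Lemma row_forward a i r I : level a i r -> i < I ->
  v I r = Some a \/ exists i', i < i' < I /\ level a.+1 i' r.
Proof.
move=> lv; elim: I => // I IH; rewrite ltnS leq_eqVlt => /predU1P[<-|hI].
  by left; apply: level_row.
have [vI|[i' [hi l']]] := IH hI; last by right; exists i'; split=> //; lia.
have [hh|hn] := eqVneq (h I r) (Some a).
  by right; exists I; rewrite hI ltnSn /= vI hh eqxx.
left; rewrite row_step vI (negbTE hn); case E: (X I r) => //.
by rewrite (rook_row_none E) in vI.
Qed.

End Rows.

(** * Shadow lines and chains of crossing cells *)

Section Grid.

Variables (X : nat -> nat -> bool) (v h : nat -> nat -> option nat).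
Hypotheses (rX : rook X) (lX : labelling X v h).

Local Notation level := (level X v h).

Lemma column_step i r : h i r.+1 = if X i r then Some 0 else
  if h i r is Some a then if v i r == Some a then Some a.+1 else Some a else None.
Proof. exact: (row_step (labelling_tr lX)). Qed.

Lemma rook_column_none i r : X i r -> h i r = None.
Proof. exact: (rook_row_none (rook_tr rX) (labelling_tr lX)). Qed.

Lemma column_back a i r : h i r = Some a ->
  exists r', [/\ r' < r, level a i r' & forall j, r' < j <= r -> h i j = Some a].
Proof.
move=> /(row_back (labelling_tr lX)) [r' [h1 h2 h3]].
by exists r'; split=> //; rewrite -level_tr.
Qed.

Lemma column_forward a i r R : level a i r -> r < R ->
  h i R = Some a \/ exists r', r < r' < R /\ level a.+1 i r'.
Proof.
rewrite -level_tr => lv /(row_forward (rook_tr rX) (labelling_tr lX) lv) [|[r' [h1 h2]]].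
  by left.
by right; exists r'; rewrite -level_tr.
Qed.

(** The row label of the first cell and the column label of the second meet at [(i', r)], unless one
    of them has met another label [a] before. *)
Lemma level_up a i r i' r' : level a i r -> level a i' r' -> i < i' -> r' < r ->
  exists c, [/\ level a.+1 c.1 c.2, i < c.1 <= i' & r' < c.2 <= r].
Proof.
move=> l1 l2 hi hr.
have [va|[j [hj lj]]] := row_forward rX lX l1 hi; last by exists (j, r); split=> //=; lia.
have [ha|[j [hj lj]]] := column_forward l2 hr; last by exists (i', j); split=> //=; lia.
by exists (i', r); split=> /=; [rewrite va ha eqxx | lia | lia].
Qed.

(** The column label [a] entering [(i, r)] and the row label [a] entering [(i', r')] are traced back
    to their sources. If both sources lay outside the required rectangle, the two labels would pass
    through [(i, r')] and change there. *)
Lemma level_down a i r i' r' : level a.+1 i r -> level a.+1 i' r' -> i < i' -> r' < r ->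
  exists c, [/\ level a c.1 c.2, i <= c.1 < i' & r' <= c.2 < r].
Proof.
move=> /andP[/eqP vi /eqP hi] /andP[/eqP vi' /eqP hi'] ii rr.
have [r2 [h1 l2 h2]] := column_back hi.
have [i1 [h3 l1 h4]] := row_back lX vi'.
have [?|lt2] := leqP r' r2; first by exists (i, r2); split=> //=; lia.
have [?|lt1] := leqP i i1; first by exists (i1, r'); split=> //=; lia.
have e1 : v i r' = Some a by apply: h4; lia.
have e2 : h i r' = Some a by apply: h2; lia.
have : h i r'.+1 = Some a by apply: h2; lia.
rewrite column_step e1 e2 eqxx; case E: (X i r'); first by rewrite (rook_column_none E) in e2.
by case; lia.
Qed.

Definition cross (p q : nat * nat) := (p.1 < q.1) && (q.2 < p.2).

Lemma cross_trans : transitive cross.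
Proof. by move=> q p s; rewrite /cross; lia. Qed.

Lemma cross_last p s : path cross p s -> p.1 <= (last p s).1.
Proof.
elim: s p => //= q s IH p /andP[/andP[h1 _] /IH].
by apply: leq_trans; apply: ltnW.
Qed.

Lemma level_chain_up a p s : path cross p s -> all (fun c => level a c.1 c.2) (p :: s) ->
  exists s', [/\ size s' = size s, sorted cross s' &
    all (fun c => [&& level a.+1 c.1 c.2, p.1 < c.1, c.1 <= (last p s).1 & c.2 <= p.2]) s'].
Proof.
elim: s p => [|q s IH] p /=; first by exists [::].
move=> /andP[/andP[h1 h2] pa] /and3P[lp lq ls].
have [|s' [sz so al]] := IH q pa; first by rewrite /= lq.
have [c [lc /andP[c1 c2] /andP[c3 c4]]] := level_up lp lq h1 h2.
have hl := cross_last pa.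
exists (c :: s'); split; rewrite /= ?sz //.
  rewrite (path_sortedE cross_trans) so andbT.
  apply/allP => d /(allP al) /and4P[_ d1 d2 d3]; apply/andP; split; lia.
move: lc => /= ->; rewrite c1 c4 (leq_trans c2 hl) /=.
by apply/allP => d /(allP al) /= /and4P[-> d1 -> d3] /=; lia.
Qed.

(** Each pair of neighbours yields one cell between them; the source of the column label of the last
    cell yields one more. *)
Lemma level_chain_down a p s : path cross p s -> all (fun c => level a.+1 c.1 c.2) (p :: s) ->
  exists s', [/\ size s' = (size s).+1, sorted cross s' &
    all (fun c => [&& level a c.1 c.2, p.1 <= c.1, c.1 <= (last p s).1 & c.2 < p.2]) s'].
Proof.
elim: s p => [|q s IH] p /=.
  move=> _ /andP[/andP[_ /eqP /column_back [r' [h1 h2 _]]] _].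
  by exists [:: (p.1, r')]; rewrite /= h2 h1 leqnn.
move=> /andP[/andP[h1 h2] pa] /and3P[lp lq ls].
have [|s' [sz so al]] := IH q pa; first by apply/andP.
have [c [lc /andP[c1 c2] /andP[c3 c4]]] := level_down lp lq h1 h2.
have hl := cross_last pa.
exists (c :: s'); split; rewrite /= ?sz //.
  rewrite (path_sortedE cross_trans) so andbT.
  apply/allP => d /(allP al) /and4P[_ d1 d2 d3]; apply/andP; split; lia.
rewrite lc c1 c4 (leq_trans (ltnW c2) hl) /=.
by apply/allP => d /(allP al) /and4P[-> d1 -> d3] /=; lia.
Qed.

(** Each passage to the next level costs one cell of the chain, until a single cell is left. *)
Lemma crossing_level_up a p s : path cross p s -> all (fun c => level a c.1 c.2) (p :: s) ->
  exists c, [/\ level (a + size s) c.1 c.2, c.1 <= (last p s).1 & c.2 <= p.2].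
Proof.
elim: {s}(size s) {-2}s (erefl (size s)) a p => [|k IH] s sz a p pa al.
  by case: s sz pa al => // _ _ /= /andP[lp _]; exists p; rewrite addn0.
have [[|q t] [sz' so' al']] := level_chain_up pa al; first by rewrite -sz' in sz.
rewrite -sz' in sz; case: sz => sz.
have [||c [c1 c2 c3]] := IH t sz a.+1 q; first exact: so'.
  by apply: sub_all al' => c /and4P[].
exists c; split; first by rewrite -sz' addnS -addSn.
  apply: leq_trans c2 _; have /(allP al') /and4P[_ _ //] := mem_last q t.
by apply: leq_trans c3 _; move: al' => /= /andP[/and4P[]].
Qed.

Lemma crossing_level_down a k c : level (a + k) c.1 c.2 ->
  exists p s, [/\ path cross p s, size s = k, all (fun c => level a c.1 c.2) (p :: s),
    (last p s).1 <= c.1 & p.2 <= c.2].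
Proof.
elim: k a => [|k IH] a lc; first by exists c, [::]; rewrite addn0 in lc; rewrite /= lc.
have [|p [s [pa sz al l1 l2]]] := IH a.+1; first by rewrite addSnnS.
have [s' [sz' so' al']] := level_chain_down pa al.
(* The source of the row label entering the first cell lengthens the chain by one. *)
have /andP[/andP[/eqP vp _] _] := al.
have [i [hi li _]] := row_back lX vp.
case: s' sz' so' al' => // q t [sz'] so' al'.
exists (i, p.2), (q :: t); split=> //=.
- rewrite (so' : path cross q t) andbT /cross /=; move: al' => /= /andP[/and4P[_ h1 _ ->] _].
  by rewrite (leq_trans hi).
- by rewrite sz' sz.
- by rewrite li; apply: sub_all al' => d /and4P[].
- apply: leq_trans l1; have /(allP al') /and4P[_ _ //] := mem_last q t.
Qed.

(** * Partitions at the corners of the board and last passage percolation *)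

(* The partition at the upper left corner of the cell [(i, r)]. *)
Definition shape i r a := \sum_(j < i) (h j r == Some a).

Lemma shapeS i r a : shape i.+1 r a = shape i r a + (h i r == Some a).
Proof. by rewrite /shape big_ord_recr. Qed.

Lemma shape_row0 i a : shape i 0 a = 0.
Proof. by have [_ h0 _] := lX; rewrite /shape big1 // => j _; rewrite h0. Qed.

(** Every cell is balanced: the incoming column label with the outgoing row label are the same boxes
    as the incoming row label with the outgoing column label. Hence the partitions do not depend on
    the route. *)
Lemma shape_down i r a : shape i r.+1 a = shape i r a + (v i r == Some a).
Proof.
elim: i => [|i IH]; first by have [v0 _ _] := lX; rewrite v0 /shape !big_ord0.
rewrite !shapeS IH -!addnA; congr (_ + _).
rewrite column_step (row_step lX); case E: (X i r).
  by rewrite (rook_column_none E) (rook_row_none rX lX E).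
case: (v i r) => [b|]; case: (h i r) => [c|] /=; try lia.
by rewrite ![Some _ == Some _](inj_eq Some_inj) [b == c]eq_sym;
  case: (c =P b) => [->|]; rewrite /= ?(inj_eq Some_inj); lia.
Qed.

Lemma shape_part i r : part (shape i r).
Proof.
elim: r i => [|r IHr] i; first by move=> a; rewrite !shape_row0.
elim: i => [|i IHi] a; first by rewrite /shape !big_ord0.
have := IHr i a; have := IHr i.+1 a; have := IHi a.
rewrite !shapeS !shape_down.
rewrite column_step; case E: (X i r).
  rewrite (rook_column_none E) (rook_row_none rX lX E) /=; lia.
have := IHr i.+1 a.-1; rewrite shapeS.
case: (v i r) => [b|]; case: (h i r) => [c|];
  rewrite ?eqxx ?[Some _ == Some _](inj_eq Some_inj) /=; try lia.
have := @IHr i.+1 a; rewrite !shapeS.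
case: (b =P c) => [->|]; rewrite ?[Some _ == Some _](inj_eq Some_inj) /=; try lia.
Qed.

Lemma shape_corner i r : X i r -> shape i.+1 r.+1 0 = (shape i r 0).+1.
Proof.
move=> x; rewrite shapeS shape_down column_step x (rook_row_none rX lX x) /=.
by rewrite addn0 addn1.
Qed.

Lemma shape_max i r : ~~ X i r ->
  shape i.+1 r.+1 0 = shape i.+1 r 0 \/ shape i.+1 r.+1 0 = shape i r.+1 0.
Proof.
move=> x; rewrite !shapeS !shape_down column_step (negbTE x).
case: (v i r) => [b|]; case: (h i r) => [c|] /=; try lia.
by rewrite ?[Some _ == Some _](inj_eq Some_inj); case: (b =P c) => [->|] /=;
  rewrite ?[Some _ == Some _](inj_eq Some_inj); lia.
Qed.

Definition outside (p q : nat * nat) := (q.1 < p.1) && (q.2 < p.2).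

Lemma outside_trans : transitive outside.
Proof. by move=> q p s; rewrite /outside; lia. Qed.

Lemma shape_mono i i' r r' : i <= i' -> r <= r' -> shape i r 0 <= shape i' r' 0.
Proof.
move=> hi hr; apply: (@leq_trans (shape i r' 0)).
  by elim: r' hr => [|r' IH]; [case: r | rewrite leq_eqVlt => /predU1P[->//|/IH]; rewrite shape_down; lia].
elim: i' hi => [|i' IH]; first by case: i.
by rewrite leq_eqVlt => /predU1P[->//|/IH]; rewrite shapeS; lia.
Qed.

(** The first row obeys the recursion of last passage percolation: across a filled cell it grows by
    one over the opposite corner, across an empty one it is the larger of the values at the two
    neighbouring corners. *)
Lemma nesting_shape k i r : k <= shape i r 0 <->
  exists s, [/\ size s = k, sorted outside s &
    all (fun c => [&& X c.1 c.2, c.1 < i & c.2 < r]) s].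
Proof.
split; last first.
  move=> [s [<- so al]] {k}; elim: s i r so al => // c s IH i r /= pa /andP[/and3P[x hi hr] al].
  apply: leq_trans (shape_mono hi hr); rewrite shape_corner // ltnS.
  move: pa; rewrite (path_sortedE outside_trans) => /andP[ac so].
  apply: IH => //; apply/allP => d ds; have /and3P[-> _ _] := allP al d ds.
  exact: (allP ac d ds).
have [n] := ubnP (i + r); elim: n i r k => // n IH [|i] [|r] k; rewrite ltnS => hn.
1-3: by rewrite ?shape_row0 /shape ?big_ord0 leqn0 => /eqP ->; exists [::].
have widen (i' r' : nat) : i' <= i.+1 -> r' <= r.+1 -> i' + r' < n -> k <= shape i' r' 0 ->
  exists s, [/\ size s = k, sorted outside s &
    all (fun c => [&& X c.1 c.2, c.1 < i.+1 & c.2 < r.+1]) s].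
  move=> hi hr hn' /(IH _ _ _ hn') [s [sz so al]]; exists s; split=> //.
  by apply: sub_all al => c /and3P[-> h1 h2]; lia.
case E: (X i r).
  rewrite shape_corner //; case: k {widen} => [|k hk]; first by exists [::].
  have [|s [sz so al]] := IH i r k _ hk; first by lia.
  exists ((i, r) :: s); rewrite /= sz E !ltnSn (path_sortedE outside_trans) so andbT.
  split=> //; first by apply: sub_all al => c /and3P[_ h1 h2]; apply/andP.
  by apply: sub_all al => c /and3P[-> h1 h2]; lia.
by have [->|->] := shape_max (negbT E); apply: widen; lia.
Qed.

(** * Labels in two adjacent columns *)

Lemma rook_column i r r' : X i r' -> r' < r -> h i r != None.
Proof. exact: (rook_row (labelling_tr lX)). Qed.

Lemma column_label i r y : h i r = Some y ->
  h i r.+1 = Some (y + (v i r == Some y)) /\ X i r = false.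
Proof.
move=> hy; rewrite column_step hy; case E: (X i r).
  by rewrite (rook_column_none E) in hy.
by case: ifP; rewrite ?addn1 ?addn0.
Qed.

Lemma row_label i r y : h i r = Some y ->
  v i.+1 r = omap (fun a => a + (a == y)) (v i r).
Proof.
move=> hy; have [_ E] := column_label hy; rewrite (row_step lX) E hy.
case: (v i r) => //= a; rewrite (inj_eq Some_inj) eq_sym.
by case: eqP; rewrite ?addn1 ?addn0.
Qed.

(** The inequality survives each further row: a row label equal to [y] leaves column [i] as [y + 1]
    and misses [y'], so [y'] is raised only when [y' < y]. *)
Lemma adjacent_nest i r0 r1 r : X i r0 -> X i.+1 r1 -> r0 < r1 -> r1 < r ->
  exists y y', [/\ h i r = Some y, h i.+1 r = Some y' & y' <= y].
Proof.
move=> x0 x1 h01; elim: r => // r IH; rewrite ltnS leq_eqVlt => /predU1P[e|/IH].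
  have := rook_column x0 h01; case E: (h i r1) => [y|] // _.
  rewrite -e; have [-> _] := column_label E; rewrite column_step x1.
  by do 2!eexists.
move=> [y [y' [hy hy' le]]].
have [-> _] := column_label hy; have [-> _] := column_label hy'.
rewrite (row_label hy); do 2!eexists; split=> //.
case: (v i r) => [a|] /=; rewrite ?(inj_eq Some_inj); lia.
Qed.

(** When a row label raises [y] to [y + 1 = y'], the same label arrives at the next column as [y']
    and raises it as well. *)
Lemma adjacent_cross i r0 r1 r : X i r0 -> X i.+1 r1 -> r1 < r0 -> r0 < r ->
  exists y y', [/\ h i r = Some y, h i.+1 r = Some y' & y < y'].
Proof.
move=> x0 x1 h01; elim: r => // r IH; rewrite ltnS leq_eqVlt => /predU1P[e|/IH].
  rewrite -e column_step x0.
  have := rook_column x1 h01; case E: (h i.+1 r0) => [y'|] // _.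
  have [-> _] := column_label E.
  rewrite (row_step lX) x0 (inj_eq Some_inj); do 2!eexists; split=> //; lia.
move=> [y [y' [hy hy' le]]].
have [-> _] := column_label hy; have [-> _] := column_label hy'.
rewrite (row_label hy); do 2!eexists; split=> //.
case: (v i r) => [a|] /=; rewrite ?(inj_eq Some_inj); lia.
Qed.

End Grid.

(** * Inverse growth rules: fillings from diagonal labels *)

(** The growth rule read backwards, from outgoing to incoming labels; two labels 0 can only come
    from a filled cell, which [rmark] detects. *)
Definition rcell (v h : option nat) : option nat * option nat :=
  if v is Some a then
    if h == Some a then if a is b.+1 then (Some b, Some b) else (None, None) else (v, h)
  else (v, h).

Definition rmark (v h : option nat) : bool := (v == Some 0) && (h == Some 0).

Lemma cellK v h : cell (rmark v h) (rcell v h).1 (rcell v h).2 = (v, h).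
Proof.
rewrite /cell /rcell /rmark; case: v => [a|] //=; case: (h =P Some a) => [->|e] /=.
  by case: a => //= a; rewrite eqxx.
by rewrite (introF eqP e) andbC; case: (h =P Some 0) e => //= ->; case: a.
Qed.

Lemma rcellK (x : bool) v h : (x -> v = None /\ h = None) ->
  let c := cell x v h in rmark c.1 c.2 = x /\ rcell c.1 c.2 = (v, h).
Proof.
rewrite /cell /rcell /rmark; case: x => [[//|-> ->] //|_] /=.
case: v => [a|] //=; case: (h =P Some a) => [->|e] /=; first by rewrite eqxx.
by rewrite (introF eqP e); split=> //; case: a e => //= /eqP/negbTE ->.
Qed.

(** A zigzag of partitions from empty to empty along an antidiagonal: peaks [S i] and valleys [M i],
    where [w i] holds the boxes by which the peaks before and after [M i] exceed it. *)
Definition diag_path n (w : nat -> option nat * option nat) : Prop :=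
  exists S M : nat -> nat -> nat,
    [/\ forall a, S 0 a = 0 /\ S n a = 0, forall i, i <= n -> part (S i),
        forall i, i < n -> part (M i) &
        forall i, i < n -> forall b, S i b = M i b + ((w i).1 == Some b) /\
                                     S i.+1 b = M i b + ((w i).2 == Some b)].

Lemma diag_path_ends n w : diag_path n.+1 w -> (w 0).1 = None /\ (w n).2 = None.
Proof.
move=> [S [M [h0 _ _ hw]]]; split.
  case E: (w 0).1 => [b|] //; have [+ _] := hw 0 isT b.
  by rewrite (h0 b).1 E eqxx addn1.
case E: (w n).2 => [b|] //; have [_] := hw n (ltnSn n) b.
by rewrite (h0 b).2 E eqxx addn1.
Qed.

Lemma diag_path_rcell n w : diag_path n.+1 w ->
  diag_path n (fun i => rcell (w i.+1).1 (w i).2).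
Proof.
move=> [S [M [h0 pS pM hw]]].
(* The valleys become the peaks of the next antidiagonal; a new valley lacks the box given by the
   inverse rule. *)
exists M, (fun i b => M i b - ((rcell (w i.+1).1 (w i).2).1 == Some b)).
split=> [a|i hi|i hi a|i hi b].
- have [e1 e2] := h0 a.
  have [e3 _] := hw 0 isT a; have [_ e4] := hw n (ltnSn n) a; lia.
- by apply: pM; rewrite ltnS.
- have [_ e1] := hw i (ltnW hi) a; have [e2 _] := hw i.+1 hi a.
  have [_ e3] := hw i (ltnW hi) a.+1; have [e4 _] := hw i.+1 hi a.+1.
  have p1 := pS i.+1 (ltnW hi) a; have p2 := pM i (ltnW hi) a; have p3 := pM i.+1 hi a.
  move: e1 e2 e3 e4; rewrite /rcell.
  case: (w i.+1).1 => [v|]; case: (w i).2 => [h|] /=; try lia.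
  rewrite ?(inj_eq Some_inj); case: (h =P v) => [->|]; try lia.
    by case: v => [|v] /=; rewrite ?(inj_eq Some_inj); lia.
  by rewrite /= ?(inj_eq Some_inj); lia.
have [_ e1] := hw i (ltnW hi) b; have [e2 _] := hw i.+1 hi b.
have [_ e3] := hw i (ltnW hi) b.+1; have [e4 _] := hw i.+1 hi b.+1.
have p1 := pS i.+1 (ltnW hi) b.
move: e1 e2 e3 e4; rewrite /rcell.
case: (w i.+1).1 => [v|]; case: (w i).2 => [h|] /=; rewrite ?(inj_eq Some_inj); try lia.
case: (h =P v) => [->|]; first by case: v => [|v] /=; rewrite ?(inj_eq Some_inj); lia.
by rewrite /= ?(inj_eq Some_inj); lia.
Qed.

(* The labels entering the cells [(i, r)] with [i + r + d] constant, computed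
   from those with [d = 0]. *)
Fixpoint undiag (w : nat -> option nat * option nat) d : nat -> option nat * option nat :=
  if d is d'.+1 then fun i => rcell (undiag w d' i.+1).1 (undiag w d' i).2 else w.

Lemma diag_path_undiag n w d : d <= n -> diag_path n w -> diag_path (n - d) (undiag w d).
Proof.
move=> + pw; elim: d => [|d IH] hd /=; first by rewrite subn0.
by apply: diag_path_rcell; rewrite -subSn // subSS; apply: IH; apply: ltnW.
Qed.

Definition triangle_labelling n X (v h : nat -> nat -> option nat) : Prop :=
  [/\ forall r, r < n -> v 0 r = None, forall i, i < n -> h i 0 = None &
    forall i r, i + r.+1 < n -> (v i.+1 r, h i r.+1) = cell (X i r) (v i r) (h i r)].

Lemma labelling_triangle n X v h : labelling X v h -> triangle_labelling n X v h.
Proof. by move=> [h1 h2 h3]; split=> *. Qed.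

Lemma triangle_labelling_uniq n X v h v' h' :
  triangle_labelling n X v h -> triangle_labelling n X v' h' ->
  forall i r, i + r < n -> v i r = v' i r /\ h i r = h' i r.
Proof.
move=> [v0 h0 vh] [v0' h0' vh'] i r; have [s] := ubnP (i + r).
elim: s i r => // s IH i r hs hn; split.
  case: i hs hn => [|i] hs hn; first by rewrite v0 // v0'.
  have [||e1 e2] := IH i r; [lia..|].
  rewrite addSnnS in hn; have /(congr1 fst) /= := vh i r hn.
  have /(congr1 fst) /= := vh' i r hn.
  by rewrite e1 e2 => -> ->.
case: r hs hn => [|r] hs hn; first by rewrite addn0 in hn; rewrite h0 // h0'.
have [||e1 e2] := IH i r; [lia..|].
have /(congr1 snd) /= := vh i r hn.
have /(congr1 snd) /= := vh' i r hn.
by rewrite e1 e2 => -> ->.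
Qed.

Lemma lab_ext n X X' : (forall i r, i + r.+1 < n -> X i r = X' i r) ->
  forall i r, i + r < n -> rlab X i r = rlab X' i r /\ clab X i r = clab X' i r.
Proof.
move=> e; apply: (@triangle_labelling_uniq n X).
  exact/labelling_triangle/labelling_lab.
have [h1 h2 h3] := labelling_lab X'; split=> // i r hir.
by rewrite h3 e.
Qed.

(** The inverse rules recover all labels above the diagonal, and with them the filled cells. They
    apply because a filled cell of a rook filling receives no label. *)
Lemma lab_inj n X X' : rook X -> rook X' ->
  (forall t, t < n -> rlab X t (n.-1 - t) = rlab X' t (n.-1 - t) /\
                      clab X t (n.-1 - t) = clab X' t (n.-1 - t)) ->
  forall i r, i + r.+1 < n -> X i r = X' i r.
Proof.
move=> rX rX' e.
have lX := labelling_lab X; have lX' := labelling_lab X'.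
have key i r : (X i r -> rlab X i r = None /\ clab X i r = None) /\
               (X' i r -> rlab X' i r = None /\ clab X' i r = None).
  by split=> x; rewrite ?(rook_row_none _ lX x) ?(rook_column_none _ lX x)
                        ?(rook_row_none _ lX' x) ?(rook_column_none _ lX' x).
have [_ _ h3] := lX; have [_ _ h3'] := lX'.
have agree d : forall i r, i + r + d = n.-1 -> 0 < n ->
    rlab X i r = rlab X' i r /\ clab X i r = clab X' i r.
  elim: d => [|d IH] i r hd hn.
    have -> : r = n.-1 - i by lia.
    by apply: e; lia.
  have [|//|e1 _] := IH i.+1 r; first lia.
  have [|//|_ e2] := IH i r.+1; first lia.
  have [_] := rcellK (key i r).1; have [_] := rcellK (key i r).2.
  by rewrite -h3 -h3' /= e1 e2 => -> [-> ->].
move=> i r hir.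
have [||e1 _] := agree (n.-1 - (i.+1 + r)) i.+1 r; [lia..|].
have [||_ e2] := agree (n.-1 - (i + r.+1)) i r.+1; [lia..|].
have [+ _] := rcellK (key i r).1; have [+ _] := rcellK (key i r).2.
by rewrite -h3 -h3' /= e1 e2 => -> ->.
Qed.

(** The inverse rules are run from the diagonal to the border, where the zigzag has shrunk so far
    that no label remains; by uniqueness the labels found are those grown from the filling. *)
Lemma lab_surj n w : diag_path n w -> exists X,
  [/\ rook X, forall i r, X i r -> i + r.+1 < n &
      forall t, t < n -> (rlab X t (n.-1 - t), clab X t (n.-1 - t)) = w t].
Proof.
move=> pw.
pose g i r := undiag w (n.-1 - (i + r)) i.
pose X i r := (i + r.+1 < n) && rmark (g i.+1 r).1 (g i r.+1).2.
have lg i r : i + r.+1 < n -> g i r = rcell (g i.+1 r).1 (g i r.+1).2.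
  move=> hir; rewrite /g; have -> : n.-1 - (i + r) = (n.-1 - (i + r.+1)).+1 by lia.
  by rewrite /= addSnnS.
have tl : triangle_labelling n X (fun i r => (g i r).1) (fun i r => (g i r).2).
  split=> [r hr|i hi|i r hir].
  - have := @diag_path_undiag n w (n.-1 - r) _ pw.
    have -> : n - (n.-1 - r) = r.+1 by lia.
    by case/(_ _)/diag_path_ends => //; lia.
  - have := @diag_path_undiag n w (n.-1 - i) _ pw.
    have -> : n - (n.-1 - i) = i.+1 by lia.
    by rewrite /g addn0; case/(_ _)/diag_path_ends => //; lia.
  by rewrite /X hir (lg i r hir) /= cellK.
have lX := labelling_lab X.
have un := triangle_labelling_uniq tl (labelling_triangle n lX).
have xn i r : X i r -> rlab X i r = None /\ clab X i r = None.
  case/andP => hir mk; have [|<- <-] := un i r; first lia.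
  rewrite (lg i r hir); move: mk; rewrite /rmark /rcell.
  by case/andP => /eqP -> /eqP ->.
exists X; split.
(* A marked cell receives no label, whereas an earlier filled cell in its row or column would send
   one. *)
- split=> i j r x x'.
    have [_] := xn _ _ x; have [_] := xn _ _ x'.
    by case: (ltngtP j r) => // hj; [move=> /eqP + _ | move=> _ /eqP]; rewrite (negbTE (rook_column lX _ hj)).
  have [+ _] := xn _ _ x; have [+ _] := xn _ _ x'.
  by case: (ltngtP i j) => // hj; [move=> /eqP + _ | move=> _ /eqP]; rewrite (negbTE (rook_row lX _ hj)).
- by move=> i r /andP[].
move=> t ht; have [|<- <-] := un t (n.-1 - t); first lia.
rewrite /g; have -> : n.-1 - (t + (n.-1 - t)) = 0 by lia.
by rewrite /=; case: (w t).
Qed.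

Lemma row_mono X v h i j r a : rook X -> labelling X v h ->
  v i r = Some a -> i <= j -> exists2 b, a <= b & v j r = Some b.
Proof.
move=> rX lX vi; elim: j => [|j IH]; first by case: i vi => // vi _; exists a.
rewrite leq_eqVlt => /predU1P[<-|/IH [b ab vj]]; first by exists a.
rewrite (row_step lX) vj; case E: (X j r); first by rewrite (rook_row_none rX lX E) in vj.
by case: ifP => _; [exists b.+1; rewrite ?leqW | exists b].
Qed.

(** * The walk of an involution *)

Definition letter_of (v h : option nat) : letter :=
  if v is Some a then Some (false, a) else if h is Some a then Some (true, a) else None.

(** This fills a whole square: each arc also appears as its mirror cell and each fixed point on the
    diagonal. The labels entering the diagonal depend only on the cells with [i + r.+1 < n], where
    each arc appears once. *)
Definition arcs n (s : nat -> nat) i r := [&& i < n, r < n & s i == n.-1 - r].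

(* The label entering the diagonal cell of [t] from the left is the row of the
   box removed at time [t]; the one entering from the top, of the box added. *)
Definition word n (s : nat -> nat) : seq letter :=
  mkseq (fun t => letter_of (rlab (arcs n s) t (n.-1 - t)) (clab (arcs n s) t (n.-1 - t))) n.

Section Word.

Variables (n : nat) (s : nat -> nat).
Hypotheses (sK : involutive s) (s_lt : forall i, i < n -> s i < n).

Local Notation X := (arcs n s).
Local Notation v := (rlab X).
Local Notation h := (clab X).
Local Notation w := (word n s).

Lemma arcsE i j : i < n -> j < n -> X i (n.-1 - j) = (s i == j).
Proof. by move=> hi hj; rewrite /arcs hi; lia. Qed.

Lemma arcs_rook : rook X.
Proof.
split=> [i r r'|i i' r] /and3P[h1 h2 /eqP e1] /and3P[h3 h4 /eqP e2]; first lia.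
by apply: (inv_inj sK); rewrite e1 e2.
Qed.

Lemma arcs_labelling : labelling X v h. Proof. exact: labelling_lab. Qed.

Lemma closerE t : t < n -> (v t (n.-1 - t) != None) = (s t < t).
Proof.
move=> ht; apply/idP/idP => [/(row_neq0 arcs_labelling) [i hi]|hs].
  rewrite arcsE //; last lia.
  by move/eqP => e; rewrite -e sK e.
apply: (rook_row arcs_labelling) hs; rewrite arcsE ?sK //; exact: s_lt.
Qed.

Lemma openerE t : t < n -> (h t (n.-1 - t) != None) = (t < s t).
Proof.
move=> ht; apply/idP/idP => [|hs].
  by case/(row_neq0 (labelling_tr arcs_labelling)) => r hr /and3P[_ _ /eqP]; lia.
have lt := s_lt ht.
apply: (@rook_column _ _ _ arcs_labelling _ _ (n.-1 - s t)); last lia.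
by rewrite arcsE.
Qed.

Lemma size_word : size w = n. Proof. exact: size_mkseq. Qed.

Lemma nth_word t : t < n ->
  [/\ removal (nth None w t) = v t (n.-1 - t), addition (nth None w t) = h t (n.-1 - t) &
    match nth None w t with
    | None => s t = t
    | Some (true, _) => t < s t
    | Some (false, _) => s t < t
    end].
Proof.
move=> ht; rewrite nth_mkseq //; have := closerE ht; have := openerE ht.
by case: (v _ _) => [a|]; case: (h _ _) => [b|] //=; case: ltngtP.
Qed.

(** The corners [(t, n - t)] run along the diagonal. Two consecutive ones exceed their common
    neighbour [(t, n.-1 - t)] by the labels entering the diagonal cell of [t]. *)
Lemma walk_word : walk (fun=> 0) w /\
  forall t, t <= n -> state (fun=> 0) w t =1 shape h t (n - t).
Proof.
have [||||wk st] := @walk_intro (fun=> 0) w (fun t => shape h t (n - t)).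
- by move=> a; rewrite /shape big_ord0.
- by move=> t _; apply: shape_part arcs_rook arcs_labelling _ _.
- by move=> a; rewrite size_word subnn (shape_row0 arcs_labelling).
- rewrite size_word => t ht b; have [-> -> _] := nth_word ht.
  have -> : n - t = (n.-1 - t).+1 by lia.
  have -> : n - t.+1 = n.-1 - t by lia.
  rewrite shapeS (shape_down arcs_rook arcs_labelling); exact: addnAC.
by split=> // t ht; apply: st; rewrite size_word.
Qed.

Lemma adjacent_openers t : t.+1 < n -> t < s t -> t.+1 < s t.+1 ->
  exists a a', [/\ nth None w t = Some (true, a), nth None w t.+1 = Some (true, a') &
    (a < a') = (s t < s t.+1)].
Proof.
move=> ht o1 o2; have ht' : t < n by lia.
have l1 := s_lt ht'; have l2 := s_lt ht.
have ne : s t <> t.+1 by move=> e; have := sK t; rewrite e; lia.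
pose r := n.-1 - t.+1; have er : n.-1 - t = r.+1 by rewrite /r; lia.
(* Row [r] belongs to the opener [t.+1] and carries no label yet, so column [t] crosses it
   unchanged. The two columns can thus be compared at the same row. *)
have vn : v t r = None.
  apply/eqP/negPn/negP => /(row_neq0 arcs_labelling) [i hi].
  rewrite arcsE //; last lia.
  by move/eqP => e; have := sK i; rewrite e; lia.
have x1 : X t (n.-1 - s t) by rewrite arcsE.
have x2 : X t.+1 (n.-1 - s t.+1) by rewrite arcsE.
have : exists y y', [/\ h t r = Some y, h t.+1 r = Some y' & (y < y') = (s t < s t.+1)].
  case: (ltngtP (s t) (s t.+1)) => [lt|gt|/(inv_inj sK)]; last lia.
    have [||y [y' [h1 h2 h3]]] := adjacent_cross arcs_rook arcs_labelling x1 x2 (r := r).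
    - lia.
    - rewrite /r; lia.
    by exists y, y'.
  have [||y [y' [h1 h2 h3]]] := adjacent_nest arcs_rook arcs_labelling x1 x2 (r := r).
  - lia.
  - rewrite /r; lia.
  by exists y, y'; split=> //; lia.
move=> [y [y' [h1 h2 h3]]]; exists y, y'; split=> //.
  have [_] := nth_word ht'; rewrite er; have [-> _] := column_label arcs_rook arcs_labelling h1.
  by rewrite vn addn0; case: (nth _ _ _) => [[[] a]|] //= [->].
have [_] := nth_word ht; rewrite -/r h2.
by case: (nth _ _ _) => [[[] a]|] //= [->].
Qed.

(** The transposed comparison: the rows of [t] and [t.+1] are compared at column [t], which carries
    no label because [t] closes. *)
Lemma adjacent_closers t : t.+1 < n -> s t < t -> s t.+1 < t.+1 ->
  exists a a', [/\ nth None w t = Some (false, a), nth None w t.+1 = Some (false, a') &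
    (a' < a) = (s t < s t.+1)].
Proof.
move=> ht o1 o2; have ht' : t < n by lia.
have ne : s t.+1 <> t by move=> e; have := sK t.+1; rewrite e; lia.
pose r := n.-1 - t.+1; have er : n.-1 - t = r.+1 by rewrite /r; lia.
have hn : h t r = None.
  apply/eqP/negPn/negP => /(row_neq0 (labelling_tr arcs_labelling)) [i hi].
  by move=> /and3P[_ _ /eqP]; rewrite /r in hi; lia.
have x1 : X (s t.+1) r by rewrite arcsE ?sK //; lia.
have x2 : X (s t) r.+1 by rewrite -er arcsE ?sK //; lia.
have tX := rook_tr arcs_rook; have tl := labelling_tr arcs_labelling.
have : exists y y', [/\ v t r = Some y, v t r.+1 = Some y' & (y < y') = (s t < s t.+1)].
  case: (ltngtP (s t) (s t.+1)) => [lt|gt|/(inv_inj sK)]; last lia.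
    have [||y [y' [h1 h2 h3]]] := adjacent_cross tX tl x1 x2 (r := t) => //; first lia.
    by exists y, y'.
  have [||y [y' [h1 h2 h3]]] := adjacent_nest tX tl x1 x2 (r := t) => //.
  by exists y, y'; split=> //; lia.
move=> [y [y' [h1 h2 h3]]]; exists y', y; split=> //.
  have [+ _ _] := nth_word ht'; rewrite er h2.
  by case: (nth _ _ _) => [[[] a]|] //= [->].
have [+ _ _] := nth_word ht; rewrite -/r.
have [-> _] := column_label tX tl h1; rewrite hn addn0.
by case: (nth _ _ _) => [[[] a]|] //= [->].
Qed.

End Word.

(** * Heights of the two words as crossing and nesting sizes *)

Lemma path_ltn_last x t : path ltn x t -> x <= last x t.
Proof. by elim: t x => //= y t IH x /andP[/ltnW xy /IH]; apply: leq_trans. Qed.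

Lemma sorted_cat_cons_ltn x t y t' :
  sorted ltn (rcons t x ++ y :: t') = [&& sorted ltn (rcons t x), x < y & path ltn y t'].
Proof. by case: t => [|z t] //=; rewrite cat_path last_rcons. Qed.

Section Height.

Variables (n : nat) (s : nat -> nat).
Hypotheses (sK : involutive s) (s_lt : forall i, i < n -> s i < n).

Local Notation X := (arcs n s).
Local Notation v := (rlab X).
Local Notation h := (clab X).
Local Notation w := (word n s).

Let cells := map (fun i => (i, n.-1 - s i)).

Lemma cellsE t : all (fun c => X c.1 c.2) t -> exists2 us, t = cells us & all (gtn n) us.
Proof.
elim: t => [|[i r] t IH] /=; first by exists [::].
move=> /andP[/and3P[/= h1 h2 /eqP h3] /IH [us -> al]]; exists (i :: us); rewrite /= ?h1 //.
by rewrite h3; congr ((_, _) :: _); lia.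
Qed.

Lemma cells_arcs t : all (gtn n) t -> all (fun c => X c.1 c.2) (cells t).
Proof.
elim: t => //= i t IH /andP[hi /IH ->]; rewrite andbT /arcs hi /=.
have := s_lt hi; lia.
Qed.

Lemma cross_cells i t : all (gtn n) (i :: t) ->
  path cross (i, n.-1 - s i) (cells t) = path ltn i t && path ltn (s i) (map s t).
Proof.
elim: t i => //= j t IH i /and3P[hi hj ht]; rewrite IH /= ?hj // /cross /=.
have := s_lt hi; have := s_lt hj.
by case: (path ltn j t) (path ltn (s j) _) => [] []; lia.
Qed.

Lemma outside_cells i t : all (gtn n) (i :: t) ->
  path outside (i, n.-1 - s i) (cells t) = path gtn i t && path ltn (s i) (map s t).
Proof.
elim: t i => //= j t IH i /and3P[hi hj ht]; rewrite IH /= ?hj // /outside /=.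
have := s_lt hi; have := s_lt hj.
by case: (path gtn j t) (path ltn (s j) _) => [] []; lia.
Qed.

Lemma last_cells i t : last (i, n.-1 - s i) (cells t) = (last i t, n.-1 - s (last i t)).
Proof. by rewrite -(last_map (fun i => (i, n.-1 - s i))). Qed.

(** A removal in row [a] at time [t] is a label [a] on the row of [t], emitted in some column
    [i < t]. Below its level lie [a + 1] arcs, successively crossing, that start at [i] or before
    and end at [t] or after. *)
Lemma crossing_height r : r < height w <-> exists t,
  [/\ size t = r.+1, all (gtn n) t & sorted ltn (t ++ map s t)].
Proof.
have rX := @arcs_rook n s sK; have lX := arcs_labelling n s.
rewrite height_gt; split.
  case/(has_nthP None) => t; rewrite size_word => ht.
  have [-> _ _] := nth_word sK s_lt ht; case E: (v t _) => [a|] // ra.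
  have [i [hi li _]] := row_back lX E.
  have [|p [t' [pa sz al l1 l2]]] := crossing_level_down rX lX (a := 0) (k := a) (c := (i, n.-1 - t)).
    by rewrite add0n.
  have [[|i0 us] // [ep et'] ln] := cellsE al.
  move: pa l1 l2 sz; rewrite {}ep {}et' {p t' al} cross_cells // last_cells size_map /=.
  move=> /andP[pa1 pa2] l1 l2 sz.
  have lt0 : s i0 < n by apply: s_lt; have /andP[] := ln.
  have l3 : last i0 (take r us) <= last i0 us.
    rewrite -{2}(cat_take_drop r us) last_cat; apply: path_ltn_last.
    by move: pa1; rewrite -{1}(cat_take_drop r us) cat_path => /andP[].
  exists (i0 :: take r us); split.
  - by rewrite /= size_takel // sz.
  - by move: ln => /= /andP[-> /allP ln]; apply/allP => j /mem_take /ln.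
  - rewrite /= cat_path /= take_path //= map_take take_path // andbT; lia.
move=> [[|i t] []] // [sz] al; rewrite /= cat_path /= => /and3P[pa1 lt pa2].
have [||c [lc l1 l2]] := crossing_level_up rX lX (a := 0) (p := (i, n.-1 - s i)) (s := cells t).
- by rewrite cross_cells // pa1.
- exact: (@cells_arcs (i :: t)).
move: l1 l2; rewrite last_cells /= => l1 l2.
rewrite add0n size_map sz in lc; have v1 := level_row rX lX lc.
have hi : i < n by have /andP[] := al.
have hsi := s_lt hi.
(* Row [c.2] meets the diagonal in column [n.-1 - c.2], and its label has only grown on the way. *)
have [|b rb vb] := row_mono (j := n.-1 - c.2) rX lX v1; first by lia.
have ht : n.-1 - c.2 < n by lia.
apply/(has_nthP None); exists (n.-1 - c.2); first by rewrite size_word.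
have [-> _ _] := nth_word sK s_lt ht.
have -> : n.-1 - (n.-1 - c.2) = c.2 by lia.
by rewrite vb.
Qed.

(** The height is the longest first row reached, and the first row at the corner [(t, n - t)]
    measures nested arcs that start before [t] and end at [t] or after. Chains for [outside] list
    the arcs from the inside, hence the reversals. *)
Lemma nesting_height r : r < height (columns (fun=> 0) (fun=> 0) w) <-> exists t,
  [/\ size t = r.+1, all (gtn n) t & sorted ltn (t ++ rev (map s t))].
Proof.
have rX := @arcs_rook n s sK; have lX := arcs_labelling n s.
have [wk st] := walk_word sK s_lt.
rewrite height_columns // size_word; split.
  move=> [t ht]; rewrite st // (nesting_shape rX lX) => -[c [sz so al]].
  have [|us ec ln] := @cellsE c; first by apply: sub_all al => d /and3P[].
  move: sz so al; rewrite {}ec {c}; case: us ln => // i us ln.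
  rewrite size_map => sz so /= /andP[/and3P[_ h1 h2] _].
  exists (rev (i :: us)); rewrite size_rev -map_rev revK all_rev; split=> //.
  move: so; rewrite /= outside_cells // => /andP[pa1 pa2].
  rewrite rev_cons sorted_cat_cons_ltn pa2 andbT -rev_cons rev_sorted /=.
  rewrite (eq_path (e' := gtn)) // pa1.
  have : s i < n by apply: s_lt; have /andP[] := ln.
  lia.
move=> [t [sz al so]]; rewrite -(revK t) in sz al so; set us := rev t in sz al so.
rewrite size_rev in sz; rewrite all_rev in al.
rewrite -map_rev revK in so; case: us sz al so => // i us sz al.
rewrite rev_cons sorted_cat_cons_ltn -rev_cons rev_sorted => /and3P[pa1 lt pa2].
have hi : i < n by have /andP[] := al.
have hsi := s_lt hi.
(* The moment just after the innermost opener [i] lies under all the arcs. *)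
exists i.+1 => //; rewrite st //; apply/(nesting_shape rX lX).
have so : sorted outside (cells (i :: us)).
  by rewrite /= outside_cells // pa2 andbT.
exists (cells (i :: us)); rewrite size_map; split=> //.
have ac := @cells_arcs (i :: us) al; apply/allP => c hc; rewrite (allP ac c hc).
move: hc so; rewrite inE => /predU1P[->|hc] /=; first by move=> _; lia.
by rewrite (path_sortedE outside_trans) => /andP[/allP/(_ _ hc)]; rewrite /outside /=; lia.
Qed.

End Height.

(** * Sorting words block by block *)

Definition le_block (b : bool) (x y : nat * letter) : bool :=
  (x.1 < y.1) || ((x.1 == y.1) && le_letter b x.2 y.2).

Lemma le_block_total b : total (le_block b).
Proof.
move=> [i p] [j q]; rewrite /le_block /=.
by case: ltngtP => //= _; apply: le_letter_total.
Qed.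

Lemma le_block_trans b : transitive (le_block b).
Proof.
move=> [j q] [i p] [k r]; rewrite /le_block /=.
move=> /orP[ij|/andP[/eqP -> pq]] /orP[jk|/andP[/eqP <- qr]].
- by rewrite (ltn_trans ij jk).
- by rewrite ij.
- by rewrite jk.
- by rewrite ltnn eqxx (le_letter_trans pq qr).
Qed.

Lemma le_block_anti b : antisymmetric (le_block b).
Proof.
move=> [i p] [j q]; rewrite /le_block /=.
by case: ltngtP => //= <- /le_letter_anti ->.
Qed.

Definition resort b (bl : seq nat) (w : seq letter) : seq letter :=
  unzip2 (sort (le_block b) (zip bl w)).

Section Resort.

Variables (bl : seq nat) (w : seq letter).
Hypotheses (bl_sorted : sorted leq bl) (size_bl : size bl = size w).

Lemma resort_perm b : perm_eq (resort b bl w) w.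
Proof.
by rewrite -[X in perm_eq _ X](@unzip2_zip _ _ bl) ?size_bl // perm_map // perm_sort.
Qed.

Lemma resort_zip b : zip bl (resort b bl w) = sort (le_block b) (zip bl w).
Proof.
rewrite -[RHS]zip_unzip; congr zip.
apply: (sorted_eq leq_trans anti_leq) => //.
  have := sort_sorted (@le_block_total b) (zip bl w).
  rewrite sorted_map; apply: sub_sorted => x y /orP[/ltnW//|/andP[/eqP e _]].
  by rewrite /relpre /= e.
by rewrite -{1}(@unzip1_zip _ _ bl w) ?size_bl // perm_sym perm_map // perm_sort.
Qed.

Lemma resort_sorted b : sorted (le_block b) (zip bl (resort b bl w)).
Proof. by rewrite resort_zip sort_sorted //; apply: le_block_total. Qed.

(** Both sides sort the same letters in the same blocks, and the order is antisymmetric. *)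
Lemma resortK b b' : sorted (le_block b') (zip bl w) -> resort b' bl (resort b bl w) = w.
Proof.
move=> so; rewrite {1}/resort resort_zip.
rewrite (_ : sort (le_block b') _ = zip bl w) ?unzip2_zip ?size_bl //.
rewrite -[RHS](sorted_sort (@le_block_trans b')) //.
apply/perm_sortP; [exact: le_block_total|exact: le_block_trans|exact: le_block_anti|].
by rewrite perm_sort.
Qed.

(* Blockwise re-sorting only moves the letters [None]. *)
Lemma resort_filter b b' : sorted (le_block b') (zip bl w) ->
  [seq p <- resort b bl w | isSome p] = [seq p <- w | isSome p].
Proof.
move=> so; rewrite -[in RHS](@unzip2_zip _ _ bl w) ?size_bl // /resort !filter_map.
congr map; apply: (sorted_eq (@le_block_trans b) (@le_block_anti b)).
- by apply: sorted_filter; [exact: le_block_trans | apply: sort_sorted; exact: le_block_total].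
(* Away from [None] the orders for [b] and [b'] coincide. *)
- rewrite (@eq_in_sorted _ (preim snd isSome) _ (le_block b')) ?filter_all //.
    by apply: sorted_filter; first exact: le_block_trans.
  by move=> [i [[[] p]|]] [j [[[] q]|]].
- by apply: perm_filter; rewrite perm_sort.
Qed.

End Resort.

(** The block of a position is the number of cuts before it; [J t] cuts between [t] and [t.+1]. *)
Definition blocks (J : pred nat) n : seq nat := mkseq (fun t => count J (iota 0 t)) n.

Lemma blocks_step J t : count J (iota 0 t.+1) = count J (iota 0 t) + J t.
Proof. by rewrite -addn1 iotaD count_cat /= addn0. Qed.

Lemma blocks_sorted J n : sorted leq (blocks J n).
Proof.
apply/(sortedP 0) => t; rewrite size_mkseq => ht.
by rewrite !nth_mkseq ?(ltnW ht) // blocks_step leq_addr.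
Qed.

Lemma sorted_blocks b J n w : size w = n ->
  sorted (le_block b) (zip (blocks J n) w) <->
  forall t, t.+1 < n -> ~~ J t -> le_letter b (nth None w t) (nth None w t.+1).
Proof.
move=> sz.
have szz : size (blocks J n) = size w by rewrite size_mkseq.
have nthz t : t < n -> nth (0, None) (zip (blocks J n) w) t = (count J (iota 0 t), nth None w t).
  by move=> ht; rewrite nth_zip // nth_mkseq.
split=> [/(sortedP (0, None))|] h.
  move=> t ht jt; have := h t; rewrite size_zip szz minnn sz => /(_ ht).
  by rewrite !nthz ?(ltnW ht) // /le_block blocks_step (negbTE jt) /= addn0 ltnn eqxx.
apply/(sortedP (0, None)) => t; rewrite size_zip szz minnn sz => ht.
rewrite !nthz ?(ltnW ht) // /le_block blocks_step /=.
case E: (J t); first by rewrite addn1 ltnSn.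
by rewrite addn0 ltnn eqxx h // E.
Qed.

Lemma height_perm w w' : perm_eq w w' -> height w = height w'.
Proof. exact: perm_big. Qed.

(** * Statistics of matchings in terms of the words *)

(** Extending by the identity keeps an involution of all natural numbers. *)
Definition ext n (m : {perm 'I_n}) (i : nat) : nat :=
  if insub i is Some t then val (m (t : 'I_n)) else i.

Definition invols n : {set {perm 'I_n}} := [set m : {perm 'I_n} | [forall i, m (m i) == i]].

Definition row_word n (m : {perm 'I_n}) : seq letter := word n (ext m).
Definition column_word n (m : {perm 'I_n}) : seq letter :=
  columns (fun=> 0) (fun=> 0) (row_word m).

Lemma ext_val n (m : {perm 'I_n}) (i : 'I_n) : ext m i = m i.
Proof. by rewrite /ext valK. Qed.

Lemma ext_lt n (m : {perm 'I_n}) i : i < n -> ext m i < n.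
Proof. by move=> hi; rewrite (ext_val m (Ordinal hi)). Qed.

Lemma ext_invol n (m : {perm 'I_n}) : m \in invols n -> involutive (ext m).
Proof.
rewrite inE => /forallP mK i; have [hi|hi] := ltnP i n.
  by rewrite (ext_val m (Ordinal hi)) ext_val (eqP (mK _)).
have e : ext m i = i by rewrite /ext insubF // ltnNge hi.
by rewrite !e.
Qed.

Lemma size_row_word n (m : {perm 'I_n}) : size (row_word m) = n.
Proof. exact: size_word. Qed.

Lemma size_column_word n (m : {perm 'I_n}) : size (column_word m) = n.
Proof. by rewrite size_columns size_word. Qed.

Lemma walk_row_word n (m : {perm 'I_n}) : m \in invols n -> walk (fun=> 0) (row_word m).
Proof. by move=> /ext_invol mK; case: (walk_word mK (@ext_lt n m)). Qed.

Lemma map_ext n (m : {perm 'I_n}) (u : seq 'I_n) : map (ext m) (map val u) = map val (map m u).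
Proof. by rewrite -!map_comp; apply: eq_map => i; rewrite /= ext_val. Qed.

Lemma ordinals_of n t : all (gtn n) t -> exists u : seq 'I_n, map val u = t.
Proof.
elim: t => [|i t IH] /=; first by exists [::].
by move=> /andP[hi /IH [u <-]]; exists (Ordinal hi :: u).
Qed.

Lemma disjoint_moved n (m : {perm 'I_n}) (u : seq 'I_n) i :
  uniq (u ++ map m u) -> i \in u -> i != m i.
Proof.
rewrite cat_uniq => /and3P[_ /hasPn h _] iu; apply: contraTneq isT => e.
by have := h i; rewrite {1}e map_f // iu => /(_ isT).
Qed.

Lemma matched_tuple n (m : {perm 'I_n}) r (u v : r.-tuple 'I_n) :
  [forall a, matched_pair m (tnth u a) (tnth v a)] -> val v = map m u.
Proof.
move=> /forallP mp; have -> : v = map_tuple m u.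
  by apply: eq_from_tnth => a; rewrite tnth_map; have /andP[_ /eqP] := mp a.
by [].
Qed.

Lemma tuple_matched n (m : {perm 'I_n}) (u : seq 'I_n) : uniq (u ++ map m u) ->
  [forall a, matched_pair m (tnth (in_tuple u) a) (tnth (map_tuple m (in_tuple u)) a)].
Proof.
move=> un; apply/forallP => a; rewrite tnth_map /matched_pair eqxx andbT.
by apply: disjoint_moved un _; apply: mem_tnth (in_tuple u).
Qed.

Lemma sorted_ltn_uniq n (u : seq 'I_n) : sorted ltn (map val u) -> uniq u.
Proof. by move=> /(sorted_uniq ltn_trans ltnn) /map_uniq. Qed.

Lemma has_crossingP n (m : {perm 'I_n}) r : has_crossing m r <->
  exists t, [/\ size t = r, all (gtn n) t & sorted ltn (t ++ map (ext m) t)].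
Proof.
split.
  move=> /existsP[u /existsP[v /andP[mp so]]]; exists (map val u).
  rewrite size_map size_tuple map_ext -(matched_tuple mp) -map_cat so; split=> //.
  by apply/allP => _ /mapP[i _ ->] /=.
move=> [t [sz /ordinals_of [u e]]]; rewrite -{}e {t} in sz *.
rewrite map_ext -map_cat size_map in sz *; subst r => so.
apply/existsP; exists (in_tuple u); apply/existsP; exists (map_tuple m (in_tuple u)).
by rewrite so andbT tuple_matched // sorted_ltn_uniq.
Qed.

Lemma has_nestingP n (m : {perm 'I_n}) r : has_nesting m r <->
  exists t, [/\ size t = r, all (gtn n) t & sorted ltn (t ++ rev (map (ext m) t))].
Proof.
split.
  move=> /existsP[u /existsP[v /andP[mp so]]]; exists (map val u).
  rewrite size_map size_tuple map_ext -(matched_tuple mp) -map_rev -map_cat so; split=> //.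
  by apply/allP => _ /mapP[i _ ->] /=.
move=> [t [sz /ordinals_of [u e]]]; rewrite -{}e {t} in sz *.
rewrite map_ext -map_rev -map_cat size_map in sz *; subst r => so.
apply/existsP; exists (in_tuple u); apply/existsP; exists (map_tuple m (in_tuple u)).
rewrite so andbT tuple_matched //.
rewrite (perm_uniq (_ : perm_eq _ (u ++ rev (map m u)))) ?sorted_ltn_uniq //.
by rewrite perm_cat2l perm_sym perm_rev.
Qed.

Lemma bigmax_height n (P : pred nat) (H : nat) :
  (forall r, P r -> r <= H /\ r <= n) -> P H ->
  \max_(r < n.+1 | P r) r = H.
Proof.
move=> h PH; apply/eqP; rewrite eqn_leq; apply/andP; split.
  by apply/bigmax_leqP => r /h [].
have hH : H < n.+1 by rewrite ltnS; case: (h H PH).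
exact: (leq_bigmax_cond (Ordinal hH)).
Qed.

Lemma sorted_ltn_size n t t' : all (gtn n) t -> sorted ltn (t ++ t') -> size t <= n.
Proof.
move=> al so; have [u e] := ordinals_of al.
rewrite -e size_map -[X in _ <= X](card_ord n) cardE; apply: uniq_leq_size.
  apply: sorted_ltn_uniq; rewrite e; move: so.
  by rewrite !(sorted_pairwise ltn_trans) pairwise_cat => /and3P[].
by move=> i _; rewrite mem_enum.
Qed.

Lemma crn_height n (m : {perm 'I_n}) : m \in invols n -> crn m = height (row_word m).
Proof.
move=> /ext_invol mK; apply: bigmax_height.
  move=> r /has_crossingP [t [sz al so]]; split; last first.
    by rewrite -sz; apply: sorted_ltn_size al so.
  case: r sz => // r sz; apply/(crossing_height mK (@ext_lt n m)).
  by exists t.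
case E: (height (row_word m)) => [|r].
  by apply/has_crossingP; exists [::].
by apply/has_crossingP/(crossing_height mK (@ext_lt n m)); rewrite -/(row_word m) E.
Qed.

Lemma nest_height n (m : {perm 'I_n}) : m \in invols n -> nest m = height (column_word m).
Proof.
move=> /ext_invol mK; apply: bigmax_height.
  move=> r /has_nestingP [t [sz al so]]; split; last first.
    by rewrite -sz; apply: sorted_ltn_size al so.
  case: r sz => // r sz; apply/(nesting_height mK (@ext_lt n m)).
  by exists t.
case E: (height (column_word m)) => [|r].
  by apply/has_nestingP; exists [::].
by apply/has_nestingP/(nesting_height mK (@ext_lt n m)); rewrite -/(column_word m) E.
Qed.

Lemma ext_pt n (m : {perm 'I_n}) (i : 'I_n.-1) :
  (ext m i = m (pt i)) * (ext m i.+1 = m (pt_succ i)).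
Proof. by rewrite (ext_val m (pt i)) (ext_val m (pt_succ i)). Qed.

Lemma arcs_cross_neq n (a b c d : 'I_n) : a != c -> arcs_cross a b c d ->
  [set a; b] != [set c; d].
Proof.
move=> ac; apply: contraTneq => e.
have /set2P[/eqP|ad] : a \in [set c; d] by rewrite -e set21.
  by rewrite (negbTE ac).
have /set2P[/eqP|cb] : c \in [set a; b] by rewrite e set21.
  by rewrite eq_sym (negbTE ac).
by rewrite /arcs_cross -ad -cb /=; lia.
Qed.

(** Adjacent openers, or adjacent closers, cross exactly when their partners increase. An opener
    before a closer always gives a descent, as they are either matched or crossing. *)
Lemma mem_MDes n (m : {perm 'I_n}) (i : 'I_n.-1) : m \in invols n ->
  (i \in MDes m) = ~~ le_letter true (nth None (row_word m) i) (nth None (row_word m) i.+1).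
Proof.
move=> /ext_invol mK; have lt := @ext_lt n m.
have hi : i.+1 < n by rewrite -ltn_predRL.
have ne : pt i != pt_succ i by rewrite -val_eqE /= neq_ltn ltnSn.
rewrite inE /=.
set c1 := _ != [set _; _]; set c2 := arcs_cross _ _ _ _.
(* Crossing arcs are distinct, so this condition can be absorbed. *)
have -> : c1 && c2 = c2 by rewrite andbC; apply: andb_idr; apply: arcs_cross_neq.
rewrite /c2 {c1 c2} /arcs_cross /matched_pair /unmatched ne -!val_eqE /=
  -!(ext_pt m i).1 -!(ext_pt m i).2.
have [_ _ w1] := nth_word mK lt (ltnW hi); have [_ _ w2] := nth_word mK lt hi.
have inv1 : ext m i = i.+1 -> ext m i.+1 = i by move/(congr1 (ext m)); rewrite mK => <-.
have inv2 : ext m i.+1 = i -> ext m i = i.+1 by move/(congr1 (ext m)); rewrite mK => <-.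
have inj : ext m i <> ext m i.+1 by move/(inv_inj mK); lia.
have oo := adjacent_openers mK lt hi; have cc := adjacent_closers mK lt hi.
move: w1 w2 oo cc; rewrite -/(row_word m).
case: (nth None (row_word m) i) => [[[] a]|];
  case: (nth None (row_word m) i.+1) => [[[] a']|] w1 w2 oo cc /=; try lia.
- have [b [b' [[->] [->] e]]] := oo w1 w2; rewrite -ltnNge e; lia.
- have [b [b' [[->] [->] e]]] := cc w1 w2; rewrite -ltnNge e; lia.
Qed.

Lemma mem_Des n (m : {perm 'I_n}) (i : 'I_n.-1) : m \in invols n ->
  (i \in Des m) = ~~ le_letter false (nth None (column_word m) i) (nth None (column_word m) i.+1).
Proof.
move=> mi; have mK := ext_invol mi; have lt := @ext_lt n m.
have hi : i.+1 < n by rewrite -ltn_predRL.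
rewrite nth_columns_order ?size_row_word //; last exact: walk_row_word.
rewrite inE -(ext_pt m i).1 -(ext_pt m i).2.
have [_ _ w1] := nth_word mK lt (ltnW hi); have [_ _ w2] := nth_word mK lt hi.
have inv1 : ext m i = i.+1 -> ext m i.+1 = i by move/(congr1 (ext m)); rewrite mK => <-.
have inv2 : ext m i.+1 = i -> ext m i = i.+1 by move/(congr1 (ext m)); rewrite mK => <-.
have inj : ext m i <> ext m i.+1 by move/(inv_inj mK); lia.
have oo := adjacent_openers mK lt hi; have cc := adjacent_closers mK lt hi.
move: w1 w2 oo cc; rewrite -/(row_word m).
case: (nth None (row_word m) i) => [[[] a]|];
  case: (nth None (row_word m) i.+1) => [[[] a']|] w1 w2 oo cc /=; try lia.
- have [b [b' [[->] [->] e]]] := oo w1 w2; rewrite e; lia.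
- have [b [b' [[->] [->] e]]] := cc w1 w2; rewrite e; lia.
Qed.

(** * Bijections between involutions and closed walks *)

Lemma row_word_inj n : {in invols n &, injective (@row_word n)}.
Proof.
move=> m m' mi mi' ew.
have mK := ext_invol mi; have mK' := ext_invol mi'.
have lt := @ext_lt n m; have lt' := @ext_lt n m'.
have ea i j : i < j -> j < n -> (ext m i == j) = (ext m' i == j).
  move=> ij jn; rewrite -!(@arcsE n _ i j) //; try lia.
  apply: (@lab_inj n (arcs n (ext m)) (arcs n (ext m'))); try exact: arcs_rook; last lia.
  move=> t ht; have [<- <- _] := nth_word mK lt ht; have [<- <- _] := nth_word mK' lt' ht.
  by rewrite -/(row_word m) ew.
apply/permP => i; apply: val_inj; rewrite /= -!ext_val.
(* The words determine the arcs seen from their openers; closers follow by involutivity, and the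
   remaining points are fixed. *)
have up k : k < ext m k -> k < n -> ext m' k = ext m k.
  by move=> h kn; have := ea k _ h (lt _ kn); rewrite eqxx => /esym/eqP.
have up' k : k < ext m' k -> k < n -> ext m k = ext m' k.
  by move=> h kn; have := ea k _ h (lt' _ kn); rewrite eqxx => /eqP.
have hi := ltn_ord i.
case: (ltngtP i (ext m i)) => [h|h|h]; first by rewrite up.
  have := up (ext m i); rewrite mK => /(_ h (lt _ hi)) e.
  by rewrite -{2}e mK'.
case: (ltngtP i (ext m' i)) => [h'|h'|]; first by rewrite up'.
  have := up' (ext m' i); rewrite mK' => /(_ h' (lt' _ hi)) e.
  by rewrite -{1}e mK.
by rewrite -h.
Qed.

Lemma invol_of_relation n (E : rel 'I_n) : ssrbool.symmetric E ->
  (forall i j j', E i j -> E i j' -> j = j') ->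
  exists2 m, m \in invols n & forall i j, i != j -> (m i == j) = E i j.
Proof.
move=> sE fE; pose f i := odflt i [pick j | E i j].
have fP i j : E i j -> f i = j.
  by move=> e; rewrite /f; case: pickP => [j' /(fE _ _ _ e)->//|/(_ j)]; rewrite e.
have fK : involutive f.
  move=> i; rewrite {2}/f; case: pickP => [j e|h] /=; first by apply: fP; rewrite sE.
  by rewrite /f; case: pickP => // j; rewrite h.
exists (perm (inv_inj fK)); first by rewrite inE; apply/forallP => i; rewrite !permE fK.
move=> i j ij; rewrite permE; apply/eqP/idP => [|/fP //].
by rewrite /f; case: pickP => [k e <-|_ /= e] //; rewrite e eqxx in ij.
Qed.

Lemma letter_of_parts p : letter_of (removal p) (addition p) = p.
Proof. by case: p => [[[] a]|]. Qed.

Lemma walk_diag_path n w : size w = n -> walk (fun=> 0) w ->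
  diag_path n (fun t => (removal (nth None w t), addition (nth None w t))).
Proof.
move=> sz wk; have [//|pS z eS] := walk_state _ wk.
exists (fun t => state (fun=> 0) w t),
  (fun t b => state (fun=> 0) w t b - (removal (nth None w t) == Some b)).
split=> [a|//|t ht a|t ht b] /=.
- by rewrite -sz z; case: (w).
- have := pS t a; have := pS t.+1 a.
  have := eS t; rewrite sz => /(_ ht) e; have := e a; have := e a.+1.
  by case: (nth None w t) => [[[] c]|] /=; lia.
have := eS t; rewrite sz => /(_ ht b).
by case: (nth None w t) => [[[] c]|] /=; lia.
Qed.

Lemma row_word_surj n w : size w = n -> walk (fun=> 0) w ->
  exists2 m, m \in invols n & row_word m = w.
Proof.
move=> sz wk; have [X [rX tX wX]] := lab_surj (walk_diag_path sz wk).
have lX := labelling_lab X.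
pose A (i j : nat) := (i < j) && X i (n.-1 - j).
(* A point opening one arc and closing another would receive two labels on the diagonal, but a
   letter gives at most one. *)
have excl i j k : i < n -> j < n -> k < n -> A i j -> A k i -> False.
  move=> hi hj hk /andP[ij xij] /andP[ki xki].
  have := rook_row lX xki ki.
  have : clab X i (n.-1 - i) != None by apply: (rook_column lX xij); lia.
  by have [-> ->] := wX i hi; case: (nth None w i) => [[[] a]|].
have [||m mi mE] := @invol_of_relation n (fun i j => A i j || A j i).
- by move=> i j; rewrite orbC.
- move=> i j j' /orP[a|a] /orP[a'|a'].
  + have /andP[_ x] := a; have /andP[_ x'] := a'; apply: val_inj => /=.
    have := rX.1 _ _ _ x x'; have := ltn_ord j; have := ltn_ord j'; lia.
  + by case: (excl i j j').
  + by case: (excl i j' j).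
  + have /andP[_ x] := a; have /andP[_ x'] := a'; apply: val_inj => /=.
    exact: rX.2 x x'.
exists m => //; have mK := ext_invol mi; have lt := @ext_lt n m.
have eX i r : i + r.+1 < n -> arcs n (ext m) i r = X i r.
  move=> hir; have hi : i < n by lia.
  have hr : n.-1 - r < n by lia.
  have er : n.-1 - (n.-1 - r) = r by lia.
  rewrite -{1}er arcsE // (ext_val m (Ordinal hi)) (_ : n.-1 - r = Ordinal hr) // val_eqE mE.
    by rewrite /A /= er; case: (X i r); lia.
  by rewrite -val_eqE /=; lia.
apply: (@eq_from_nth _ None); first by rewrite size_row_word.
rewrite size_row_word => t ht; rewrite nth_mkseq //.
have [|-> ->] := lab_ext eX (i := t) (r := n.-1 - t); first lia.
by have [-> ->] := wX t ht; rewrite letter_of_parts.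
Qed.

Lemma count_unmatched n (m : {perm 'I_n}) : m \in invols n ->
  #|[set i | unmatched m i]| = count (pred1 None) (row_word m).
Proof.
move=> mi; have mK := ext_invol mi; have lt := @ext_lt n m.
rewrite cardsE cardE size_filter -[row_word m](mkseq_nth None) size_row_word.
rewrite /mkseq count_map -val_enum_ord count_map -enumT.
apply: eq_count => i /=; have [_ _] := nth_word mK lt (ltn_ord i).
rewrite -/(row_word m) unfold_in -[eqn _ _]/(_ == _ :> nat) -ext_val.
by case: (nth None _ i) => [[[] a]|] /= => [h|h|->]; rewrite ?eqxx ?(gtn_eqF h) ?(ltn_eqF h).
Qed.

Lemma count_columns lam mu w : count (pred1 None) (columns lam mu w) = count (pred1 None) w.
Proof. by elim: w lam mu => //= -[[[] a]|] w IH lam mu /=; rewrite IH. Qed.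

Definition walk_coding n (U : {perm 'I_n} -> seq letter) : Prop :=
  [/\ {in invols n, forall m, size (U m) = n /\ walk (fun=> 0) (U m)},
      {in invols n &, injective U} &
      forall w, size w = n -> walk (fun=> 0) w -> exists2 m, m \in invols n & U m = w].

Lemma row_word_coding n : walk_coding (@row_word n).
Proof.
split; [|exact: row_word_inj|exact: row_word_surj].
by move=> m mi; rewrite size_row_word; split=> //; apply: walk_row_word.
Qed.

(** The empty partition is its own conjugate, so [columns] is an involution on closed walks. *)
Lemma column_word_coding n : walk_coding (@column_word n).
Proof.
have c0 : conjugate (fun=> 0) (fun=> 0) by [].
have inv w : walk (fun=> 0) w ->
    columns (fun=> 0) (fun=> 0) (columns (fun=> 0) (fun=> 0) w) = w by exact: columnsK.
split.
- move=> m mi; rewrite size_column_word; split=> //.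
  by apply: walk_columns => //; apply: walk_row_word.
- move=> m m' mi mi' e; apply: row_word_inj => //.
  have := congr1 (columns (fun=> 0) (fun=> 0)) e.
  by rewrite /column_word !inv //; apply: walk_row_word.
move=> w sz wk; have [||m mi e] := @row_word_surj n (columns (fun=> 0) (fun=> 0) w).
- by rewrite size_columns.
- exact: walk_columns.
by exists m => //; rewrite /column_word e inv.
Qed.

(** * Equidistribution *)

Definition descents_in n (U : {perm 'I_n} -> seq letter) b J r k : {set {perm 'I_n}} :=
  [set m in invols n | [&& sorted (le_block b) (zip (blocks J n) (U m)),
     height (U m) == r & count (pred1 None) (U m) == k]].

(** Re-sorting each block by the order [b'] injects one set into the other, since sorting by [b]
    undoes it. Applied in both directions this gives equality. *)
Lemma leq_card_descents n (U U' : {perm 'I_n} -> seq letter) b b' J r k :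
  walk_coding U -> walk_coding U' ->
  #|descents_in U b J r k| <= #|descents_in U' b' J r k|.
Proof.
move=> [wU iU _] [wU' _ sU'].
pose bl := blocks J n; have sb : sorted leq bl := blocks_sorted J n.
have tr m : m \in descents_in U b J r k ->
    exists2 m', m' \in descents_in U' b' J r k & U' m' = resort b' bl (U m).
  rewrite inE => /andP[mi /and3P[so hr hk]]; have [sz wk] := wU m mi.
  have szb : size bl = size (U m) by rewrite size_mkseq.
  have pe := resort_perm szb b'.
  have [||m' mi' e] := sU' (resort b' bl (U m)).
  - by rewrite (perm_size pe).
  - by apply/walk_filter; rewrite (resort_filter szb b' so); apply/walk_filter.
  exists m' => //; rewrite inE mi' e resort_sorted //=.
  by rewrite (height_perm pe) hr (seq.permP pe).
pose f m := odflt m [pick m' in descents_in U' b' J r k | U' m' == resort b' bl (U m)].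
have fP m : m \in descents_in U b J r k ->
    f m \in descents_in U' b' J r k /\ U' (f m) = resort b' bl (U m).
  move=> /tr [m' h e]; rewrite /f; case: pickP => [m'' /andP[h' /eqP]//|/(_ m')].
  by rewrite h e eqxx.
rewrite -(card_in_imset (f := f) (D := mem (descents_in U b J r k))).
  by apply/subset_leq_card/subsetP => _ /imsetP[m /fP[h _] ->].
move=> m1 m2 h1 h2 e; have [_ e1] := fP _ h1; have [_ e2] := fP _ h2.
move: h1; rewrite inE => /andP[i1 /andP[s1 _]].
move: h2; rewrite inE => /andP[i2 /andP[s2 _]].
apply: iU => //; have [z1 _] := wU _ i1; have [z2 _] := wU _ i2.
rewrite -(resortK sb _ b' s1) ?size_mkseq // -(resortK sb _ b' s2) ?size_mkseq //.
by rewrite -e1 -e2 e.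
Qed.

Definition pred_of_ordinals n (J : {set 'I_n}) : pred nat :=
  fun t => [exists j : 'I_n, (j == t :> nat) && (j \in J)].

Lemma sub_sorted_blocks n (D J : {set 'I_n.-1}) b w : size w = n ->
  (forall i : 'I_n.-1, (i \in D) = ~~ le_letter b (nth None w i) (nth None w i.+1)) ->
  (D \subset J) = sorted (le_block b) (zip (blocks (pred_of_ordinals J) n) w).
Proof.
move=> sz hD; have sb := sorted_blocks b (pred_of_ordinals J) sz.
apply/subsetP/idP => [h|/sb h i]; first apply/sb => t ht.
  have ht' : t < n.-1 by rewrite ltn_predRL.
  apply: contraR => hl; apply/existsP; exists (Ordinal ht'); rewrite eqxx /=.
  by apply: h; rewrite hD.
rewrite hD; apply: contraR => hJ; apply: h; first by rewrite -ltn_predRL.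
apply: contra hJ => /existsP[j /andP[/eqP e hj]].
by rewrite -(val_inj e).
Qed.

Lemma card_MDes_Des_subset n k (J : {set 'I_n.-1}) r :
  #|[set m in matchings n k | (MDes m \subset J) && (crn m == r)]| =
  #|[set m in matchings n k | (Des m \subset J) && (nest m == r)]|.
Proof.
pose K := pred_of_ordinals J.
have eA m : (m \in matchings n k) = (m \in invols n) && (#|[set i | unmatched m i]| == k).
  by rewrite !inE.
have -> : [set m in matchings n k | (MDes m \subset J) && (crn m == r)] =
          descents_in (@row_word n) true K r k.
  apply/setP => m; rewrite [LHS]inE [RHS]inE eA -andbA; case mi: (m \in invols n) => //=.
  rewrite -(@sub_sorted_blocks _ (MDes m)) ?size_row_word //; last by move=> i; rewrite mem_MDes.
  by rewrite count_unmatched // crn_height // andbC -andbA.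
have -> : [set m in matchings n k | (Des m \subset J) && (nest m == r)] =
          descents_in (@column_word n) false K r k.
  apply/setP => m; rewrite [LHS]inE [RHS]inE eA -andbA; case mi: (m \in invols n) => //=.
  rewrite -(@sub_sorted_blocks _ (Des m)) ?size_column_word //; last by move=> i; rewrite mem_Des.
  by rewrite count_unmatched // nest_height // count_columns andbC -andbA.
have rc := @row_word_coding n; have cc := @column_word_coding n.
by apply/eqP; rewrite eqn_leq !leq_card_descents.
Qed.

Lemma card_subset_eq (T I : finType) (A : {set T}) (D : T -> {set I}) (P : pred T)
    (J : {set I}) :
  #|[set m in A | (D m \subset J) && P m]| =
  #|[set m in A | (D m == J) && P m]|
  + \sum_(K : {set I} | K \proper J) #|[set m in A | (D m == K) && P m]|.
Proof.
rewrite -sum1dep_card (partition_big D (fun K => K \subset J)); last first.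
  by move=> m /and3P[].
rewrite (bigD1 J) //=; congr (_ + _).
  by rewrite sum1dep_card; congr #|pred_of_set _|; apply/setP => m; rewrite !inE;
    case: eqP => [->|]; rewrite ?subxx ?andbT ?andbF.
apply: eq_big => [K|K /andP[sK _]].
  by rewrite properEneq andbC.
rewrite sum1dep_card; congr #|pred_of_set _|; apply/setP => m; rewrite !inE.
by case: eqP => [->|]; rewrite ?sK ?andbT ?andbF.
Qed.

(** Inclusion-exclusion by induction on the size of [J]: the contributions of the proper subsets
    cancel. *)
Lemma card_eq_of_subset (T I : finType) (A : {set T}) (D D' : T -> {set I}) (P P' : pred T) :
  (forall J : {set I}, #|[set m in A | (D m \subset J) && P m]|
           = #|[set m in A | (D' m \subset J) && P' m]|) ->
  forall J : {set I}, #|[set m in A | (D m == J) && P m]| = #|[set m in A | (D' m == J) && P' m]|.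
Proof.
move=> h J; have [s] := ubnP #|J|; elim: s J => // s IH J hs.
have := h J; rewrite !card_subset_eq.
rewrite (eq_bigr (fun K => #|[set m in A | (D' m == K) && P' m]|)); first by move/addIn.
by move=> K pK; apply: IH; apply: leq_trans (proper_card pK) _.
Qed.

(** Equal fibre sizes make the two lists of values permutations of each other. *)
Lemma eq_sum_stat (T : finType) (K : eqType) (R : nmodType) (A : {set T}) (f g : T -> K)
    (phi : K -> R) :
  (forall x, #|[set m in A | f m == x]| = #|[set m in A | g m == x]|) ->
  (\sum_(m in A) phi (f m) = \sum_(m in A) phi (g m))%R.
Proof.
move=> h; rewrite -!big_enum /= -(big_map f xpredT phi) -(big_map g xpredT phi).
apply: perm_big; apply/allP => x _ /=; rewrite !count_map.
have e (u : T -> K) : count (preim u (pred1 x)) (enum A) = #|[set m in A | u m == x]|.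
  rewrite -size_filter cardE; congr size.
  rewrite /enum_mem -filter_predI; apply: eq_filter => m.
  by rewrite /= !inE andbC.
by rewrite !e h.
Qed.

Local Open Scope ring_scope.

(** Identity of polynomials in q (the outer variable 'X) and x_1, ..., x_{n-1}. *)
Theorem theorem1p11 (n k : nat) (hkn : (k <= n)%N) (heven : ~~ odd (n - k)) :
  \sum_(m in matchings n k) (xmon (MDes m))%:P * 'X^(crn m)
  = \sum_(m in matchings n k) (xmon (Des m))%:P * 'X^(nest m)
    :> {poly {mpoly int[n.-1]}}.
Proof.
have h := @eq_sum_stat _ _ {poly {mpoly int[n.-1]}} (matchings n k)
  (fun m => (MDes m, crn m)) (fun m => (Des m, nest m))
  (fun x => (xmon x.1)%:P * 'X^(x.2)).
apply: h => -[J r].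
exact: (card_eq_of_subset (fun J => card_MDes_Des_subset k J r)).
Qed.
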